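(* Let $d=2m+1$ be an odd positive integer, let $\Lambda\subset G$ be a cocompact lattice obtained by the construction described in the context, and let $X_{d,\Lambda}=\Lambda\backslash G$ be the compact complex manifold obtained as the quotient of $G$ by the left action of $\Lambda$. Then $X_{d,\Lambda}$ admits a left-invariant locally conformally balanced (LCB) metric, i.e. an LCB metric induced by a left-invariant Hermitian metric on $G$.
   Context: A Hermitian metric on a complex manifold of (complex) dimension $n$ is called locally conformally balanced (LCB) if its associated form $\omega$ satisfies $d\omega^{n-1}=\theta\wedge\omega^{n-1}$ for some closed $1$-form $\theta$. The group $G$ and its complex structure. Let $m\ge 0$ and $d=2m+1$. For $\alpha'\in\mathbb{R}_{>0}$, $a=(a_1,\dots,a_d)\in\mathbb{R}^d$, $b=(b_1,\dots,b_d)\in\mathbb{R}^d$ and a real $d\times d$ array $c=(c_{ij})$, let $M(\alpha',a,b,c)$ be the $(2d+1)\times(2d+1)$ real matrix in block form $\begin{pmatrix} I_d & b & c\\ 0&\alpha'&a\\ 0&0&I_d\end{pmatrix}$, where $a$ is a row, $b$ a column, and the first $d$ rows are numbered from bottom to top: $b_i$ lies in row $d+1-i$, and $c_{ij}$ is the entry in the row containing $b_i$ and the column containing $a_j$. $G$ is the Lie group of all such matrices under matrix multiplication. Writing $\alpha'=w_2$, $(a_1,\dots,a_d)=(w_1,y_{01},x_{01},\dots,y_{0m},x_{0m})$, $b_i=y_{i0}$, $(c_{i1},\dots,c_{id})=(x_{i0},y_{i1},x_{i1},\dots,y_{im},x_{im})$ for $1\le i\le d$, the coordinates $w=w_1+\sqrt{-1}\,w_2$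 and $z_{ij}=x_{ij}+\sqrt{-1}\,y_{ij}$ ($0\le i\le d$, $0\le j\le m$, $(i,j)\ne(0,0)$) identify $G$ with $\mathbb{H}\times\mathbb{C}^{(d+1)^2/2-1}$ ($\mathbb{H}$ the upper half plane); this makes $G$ a complex manifold on which left translations are holomorphic. Let $\mathcal{Z}=\{M(1,0,0,c)\}\cong\mathbb{R}^{d^2}$. Construction of $\Lambda$. (1) Pick $N=(n_{k,j})\in SL_{2d}(\mathbb{Z})$ diagonalizable over $\mathbb{R}$ with eigenvalues $\alpha$ and $1/\alpha$, each of multiplicity $d$, where $\alpha>1$ is a real quadratic algebraic integer. (2) Pick bases $(a_i^1,\dots,a_i^{2d})$, $1\le i\le d$, of the real eigenspace of $N$ (acting on column vectors) for $\alpha$, and $(b_i^1,\dots,b_i^{2d})$, $1\le i\le d$, of the real eigenspace for $1/\alpha$. (3) Put $e_{ij}^{s,t}=b_i^sa_j^t-a_j^sb_i^t$ and $z^{s,t}=M(1,0,0,(e_{ij}^{s,t}))$ for $1\le s,t\le 2d$. Pick any cocompact lattice $D$ of $\mathcal{Z}$ containing all $z^{s,t}$, with generators $h_k=M(1,0,0,(d_{ij}^k))$, $1\le k\le d^2$. (4) Pick any integer matrix $P=(p_{k,l})$ of size $2d\times d^2$. For each $i,j$ let $(c_{ij}^1,\dots,c_{ij}^{2d})$ be the unique solution of $c_{ij}^k=\sum_{s=1}^{2d}n_{k,s}c_{ij}^s+f_{ij}^k+\sum_{l=1}^{d^2}p_{k,l}d_{ij}^l$ ($1\le k\le 2d$),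 where $f_{ij}^k=\sum_{s=1}^{2d}\frac{n_{k,s}(n_{k,s}-1)}{2}b_i^sa_j^s+\sum_{1\le s<t\le 2d}n_{k,s}n_{k,t}b_i^sa_j^t$. (5) Put $g_k=M(1,(a_i^k)_i,(b_j^k)_j,(c_{ij}^k))$ for $1\le k\le 2d$, $g_0=M(\alpha,0,0,0)$, and $\Lambda=\langle g_0,g_1,\dots,g_{2d},h_1,\dots,h_{d^2}\rangle$. This is a discrete cocompact subgroup of $G$. *)

(* Defs.v *)
From HB Require Import structures.
From mathcomp Require Import all_boot all_order all_fingroup all_algebra.
From mathcomp Require Import all_classical all_reals all_analysis.
Set Implicit Arguments.
Unset Strict Implicit.
Unset Printing Implicit Defensive.
Import Order.TTheory GRing.Theory Num.Theory.
Import numFieldNormedType.Exports.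
Local Open Scope classical_set_scope.
Local Open Scope ring_scope.

Section TensorsOnOpenSets.
Context {R : realType} {V : normedModType R}.

(* C^k on an open set: all iterated directional derivatives up to order k
   exist and are continuous (V is finite dimensional in all uses). *)
Fixpoint Ck (k : nat) (U : set V) (f : V -> R) : Prop :=
  (forall x, U x -> {for x, continuous f}) /\
  (if k is k'.+1 then
     forall v, (forall x, U x -> derivable f x v) /\ Ck k' U (fun x => 'D_v f x)
   else True).

Definition smooth (U : set V) (f : V -> R) := forall k, Ck k U f.

(* Tangent spaces of V are identified with V; the value T x v is meaningful
   only for x in the open set under consideration. *)
Definition tensor (k : nat) := V -> ('I_k -> V) -> R.

Definition vec2 (u v : V) : 'I_2 -> V := fun i => if i == ord0 then u else v.

Definition multilinear k (T : ('I_k -> V) -> R) :=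
  forall (v : 'I_k -> V) (i : 'I_k) (a : R) (u w : V),
    T [eta v with i |-> a *: u + w] =
    a * T [eta v with i |-> u] + T [eta v with i |-> w].

Definition alternating k (T : ('I_k -> V) -> R) :=
  forall (v : 'I_k -> V) (i j : 'I_k), i != j -> v i = v j -> T v = 0.

Definition smooth_tensor k (U : set V) (T : tensor k) :=
  (forall x, U x -> multilinear (T x)) /\
  (forall v, smooth U (fun x => T x v)).

Definition wedge p q (S : tensor p) (T : tensor q) : tensor (p + q) :=
  fun x v => (p`! * q`!)%:R^-1 *
    \sum_(s : 'S_(p + q)) (-1) ^+ s *
      S x (fun i => v (s (lshift q i))) * T x (fun j => v (s (rshift p j))).

Fixpoint wedge_pow (T : tensor 2) (k : nat) : tensor k.*2 :=
  if k is k'.+1 then wedge T (@wedge_pow T k') else fun _ _ => 1.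

Definition ext_d k (T : tensor k) : tensor k.+1 :=
  fun x v => \sum_(i < k.+1)
    (-1) ^+ i * 'D_(v i) (fun y => T y (fun j => v (lift i j))) x.

End TensorsOnOpenSets.
Arguments tensor {R} V k.
Arguments wedge_pow {R V} T k.

Section Manifolds.
Context {R : realType} {V : normedModType R}.

(* Manifolds modelled on V are given by families of injective local
   parametrizations of a set X by open subsets of V (inverses of charts). *)
Record patch (X : Type) := Patch { pdom : set V; pmap : V -> X }.

Definition local_rep X Y (F : X -> Y) (p : patch X) (q : patch Y)
    (x : V) (t : V -> V) :=
  \forall y \near x, pdom q (t y) /\ pmap q (t y) = F (pmap p y).

(* A tensor field is a family of local expressions, one in each patch. *)
Definition tfield X k := patch X -> tensor V k.

(* F^* T' = T, computed in patches. *)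
Definition is_pullback X Y (F : X -> Y) (A : set (patch X)) (B : set (patch Y))
    k (T : tfield X k) (T' : tfield Y k) :=
  forall p q x t, A p -> B q -> pdom p x -> local_rep F p q x t ->
  forall v, T p x v = T' q (t x) (fun i => 'd t x (v i)).

Definition tensor_field X (A : set (patch X)) k (T : tfield X k) :=
  (forall p, A p -> smooth_tensor (pdom p) (T p)) /\ is_pullback id A A T T.

Definition diff_form X (A : set (patch X)) k (T : tfield X k) :=
  tensor_field A T /\ (forall p x, A p -> pdom p x -> alternating (T p x)).

Definition closed_form X (A : set (patch X)) k (T : tfield X k) :=
  forall p x v, A p -> pdom p x -> ext_d (T p) x v = 0.

(* J is the complex structure of the model space V. The Hermitian metric is
   represented by its real part, a J-invariant Riemannian metric. *)
Definition hermitian_metric (J : V -> V) X (A : set (patch X))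
    (g : tfield X 2) :=
  tensor_field A g /\
  (forall p x, A p -> pdom p x ->
    [/\ forall u v, g p x (vec2 u v) = g p x (vec2 v u),
        forall u, u != 0 -> 0 < g p x (vec2 u u) &
        forall u v, g p x (vec2 (J u) (J v)) = g p x (vec2 u v)]).

Definition fundamental_form (J : V -> V) X (g : tfield X 2) : tfield X 2 :=
  fun p x v => g p x (vec2 (J (v ord0)) (v ord_max)).

(* n is the complex dimension. *)
Definition LCB (J : V -> V) (n : nat) X (A : set (patch X)) (g : tfield X 2) :=
  hermitian_metric J A g /\
  exists theta : tfield X 1,
    [/\ diff_form A theta, closed_form A theta &
      forall p x v, A p -> pdom p x ->
        let omega := fundamental_form J g p in
        ext_d (wedge_pow omega n.-1) x v =
        wedge (theta p) (wedge_pow omega n.-1) x v].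

End Manifolds.
Arguments patch {R} V X.

Section MatrixGroups.
Context {R : realType} {n : nat}.
Implicit Types (H K D L A : set 'M[R]_n).

Definition is_subgroup H D :=
  [/\ D `<=` H, D 1%:M, forall x y, D x -> D y -> D (x *m y) &
      forall x, D x -> D (invmx x)].

Definition gen_subgroup H A : set 'M[R]_n :=
  [set g | forall D, is_subgroup H D -> A `<=` D -> D g].

Definition cocompact_lattice H D :=
  [/\ is_subgroup H D, D `<=` isolated D &
      exists K, [/\ compact K, K `<=` H &
        H `<=` [set y | exists2 g, D g & exists2 k, K k & y = g *m k]]].

(* The projection onto L \ G; points of the quotient are the orbits. *)
Definition orbit_of L (g : 'M[R]_n) : set 'M[R]_n :=
  [set y | exists2 l, L l & y = l *m g].

End MatrixGroups.

Section TheGroup.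
Context {R : realType} {d : nat}.

Definition grpmx (al : R) (a : 'rV[R]_d) (b : 'cV[R]_d) (c : 'M[R]_d) :
    'M[R]_(d + (1 + d)) :=
  block_mx 1%:M (row_mx (\col_r b (rev_ord r) 0) (\matrix_(r, j) c (rev_ord r) j))
           0    (block_mx al%:M a 0 1%:M).

(* The coordinates (alpha', a, b, c) are stored in one square array of size
   d + 1 with rows (alpha', a) and (b_i, c_i1, ..., c_id).  Row i thus reads
   (y_i0, x_i0, y_i1, x_i1, ..., y_im, x_im), where z_00 stands for w. *)
Definition grp_of (x : 'M[R]_d.+1) : 'M[R]_(d + (1 + d)) :=
  grpmx (x ord0 ord0) (\row_j x ord0 (lift ord0 j)) (\col_i x (lift ord0 i) ord0)
    (\matrix_(i, j) x (lift ord0 i) (lift ord0 j)).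

Definition grp_dom : set 'M[R]_d.+1 := [set x | 0 < x ord0 ord0].

Definition G : set 'M[R]_(d + (1 + d)) := grp_of @` grp_dom.

Definition Zgrp : set 'M[R]_(d + (1 + d)) := 
  range (fun c : 'M[R]_d => grpmx 1 0 0 c).

(* Multiplication of all z_ij by the imaginary unit (for odd d): columns of
   even index hold imaginary parts, the next ones the matching real parts. *)
Definition Jmul (x : 'M[R]_d.+1) : 'M[R]_d.+1 :=
  \matrix_(i, k) if odd k then - x i (inord k.-1) else x i (inord k.+1).

Definition atlasG : set (patch 'M[R]_d.+1 'M[R]_(d + (1 + d))) :=
  [set Patch grp_dom grp_of].

Definition left_invariant k (T : tfield 'M[R]_(d + (1 + d)) k) :=
  forall h, G h -> is_pullback (mulmx h) atlasG atlasG T T.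

(* The parametrizations of L \ G are the local inverses, in the coordinates
   of G, of the projection; they cover L \ G as soon as L is discrete. *)
Definition atlas_quotient (L : set 'M[R]_(d + (1 + d))) :
    set (patch 'M[R]_d.+1 (set 'M[R]_(d + (1 + d)))) :=
  [set p | [/\ open (pdom p), pdom p `<=` grp_dom,
               pmap p = orbit_of L \o grp_of &
               forall x y, pdom p x -> pdom p y -> pmap p x = pmap p y -> x = y]].

End TheGroup.
Arguments G {R} d.
Arguments Zgrp {R} d.
Arguments atlasG {R} d.

Section Construction.
Context {R : realType} {d : nat}.

Definition real_quadratic_integer (al : R) :=
  exists p : {poly int},
    [/\ p \is monic, size p = 3%N, irreducible_poly (map_poly (intr : int -> rat) p)
      & root (map_poly intr p) al].

(* The rows of B form a basis of the eigenspace of A acting on columns; the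
   library's eigenspace is that of the action on row vectors. *)
Definition eigenbasis n (A : 'M[R]_n) (al : R) (B : 'M[R]_(d, n)) :=
  row_free B && (B == eigenspace A^T al)%MS.

(* a i k is a_i^k and b i k is b_i^k. *)
Definition emx (a b : 'M[R]_(d, d.*2)) (s t : 'I_(d.*2)) : 'M[R]_d :=
  \matrix_(i, j) (b i s * a j t - a j s * b i t).

Definition fmx (N : 'M[int]_(d.*2)) (a b : 'M[R]_(d, d.*2)) (k : 'I_(d.*2)) :
    'M[R]_d :=
  \matrix_(i, j)
    (\sum_(s < d.*2) ((N k s)%:~R * ((N k s)%:~R - 1) / 2) * (b i s * a j s)
     + \sum_(s < d.*2) \sum_(t < d.*2 | (s < t)%N) (N k s)%:~R * (N k t)%:~R * (b i s * a j t)).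

Definition Lambda (al : R) (a b : 'M[R]_(d, d.*2)) (c : 'I_(d.*2) -> 'M[R]_d)
    (h : 'I_(d ^ 2) -> 'M[R]_d) : set 'M[R]_(d + (1 + d)) :=
  gen_subgroup (G d)
    ([set grpmx al 0 0 0]
     `|` range (fun k => grpmx 1 (col k a)^T (col k b) (c k))
     `|` range (fun k => grpmx 1 0 0 (h k))).

End Construction.

(* Main.v *)
(* The group law is affine in the coordinate array x (rows (alpha', a) and
   (b_i, c_i)): left translation by h is x |-> A(h) x + const, where A(h) agrees
   with the identity except that its first column is that of h.  Hence A(x)^-1 dx
   is a left-invariant coframe, J (acting on columns) commutes with it, and the
   sum of the squares of its entries s_ik is a left-invariant Hermitian metric.
   The structure equations are d s_ik = - s_i0 /\ s_0k, and the Lee form turns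
   out to be s_00 = d(log alpha'), which is closed.  To see this, write
   omega^(n-1) up to a factor as the contraction of the top form omega^n with
   the bivector sum_e e /\ J e.  For each pair (X, Y) of matrices supported in
   one row, the required identity for omega^n (X, Y, ...) follows from the two
   properties of a top form O: sum_j O (.., A v_j, ..) = tr A * O (v), and
   l /\ O = 0 for every linear form l. *)
Require Import Defs.
From HB Require Import structures.
From mathcomp Require Import all_boot all_order all_fingroup all_algebra.
From mathcomp Require Import all_classical all_reals all_analysis.
From mathcomp Require Import ring lra.
Set Implicit Arguments.
Unset Strict Implicit.
Unset Printing Implicit Defensive.
Import Order.TTheory GRing.Theory Num.Theory.
Import numFieldNormedType.Exports.
Local Open Scope classical_set_scope.
Local Open Scope ring_scope.

(* Otherwise [alternating] would refer to the predicate of trigo.v. *)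
Local Notation alternating := Defs.alternating.

(** * Alternating forms, antisymmetrization and wedge products *)

Section AlternatingForms.
Context {R : realType} {V : normedModType R}.

Section Multilinear.
Variables (k : nat) (T : ('I_k -> V) -> R).
Hypothesis mT : multilinear T.
Implicit Types v : 'I_k -> V.

Lemma upd_same v i : [eta v with i |-> v i] = v :> ('I_k -> V).
Proof. by apply/funext => j /=; case: eqP => [->|]. Qed.

Lemma multilinearD v i u w :
  T [eta v with i |-> u + w] = T [eta v with i |-> u] + T [eta v with i |-> w].
Proof. by rewrite -[u in LHS]scale1r mT mul1r. Qed.

Lemma multilinear0 v i : T [eta v with i |-> 0] = 0.
Proof.
by have /eqP := multilinearD v i 0 0; rewrite addr0 eq_sym addrC -subr_eq0 addrK => /eqP.
Qed.

Lemma multilinearZ v i a u :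
  T [eta v with i |-> a *: u] = a * T [eta v with i |-> u].
Proof. by rewrite -[a *: u]addr0 mT multilinear0 addr0. Qed.

Lemma multilinearN v i u : T [eta v with i |-> - u] = - T [eta v with i |-> u].
Proof. by rewrite -scaleN1r multilinearZ mulN1r. Qed.

Lemma multilinear_sum v i (I : Type) (r : seq I) (P : pred I) (u : I -> V) :
  T [eta v with i |-> \sum_(x <- r | P x) u x] =
  \sum_(x <- r | P x) T [eta v with i |-> u x].
Proof.
elim/big_rec2: _ => [|x y1 y2 _ <-]; first exact: multilinear0.
exact: multilinearD.
Qed.

Hypothesis aT : alternating T.

(** Polarization: [T] vanishes when [v i + v j] fills both slots, and of the four terms of its
    expansion only the two mixed ones survive. *)
Lemma alternating_swap v i j : i != j -> T (v \o tperm i j) = - T v.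
Proof.
move=> ij; have := aT (v := fun l => if (l == i) || (l == j) then v i + v j else v l) ij.
rewrite !eqxx orbT => /(_ erefl).
set w := (X in T X).
have wE u1 u2 : [eta [eta v with i |-> u1] with j |-> u2] =
    [eta [eta v with j |-> u2] with i |-> u1] :> ('I_k -> V).
  by apply/funext => l /=; case: eqP => // ->; rewrite eq_sym (negPf ij).
have -> : w = [eta [eta v with i |-> v i + v j] with j |-> v i + v j].
  by apply/funext => l; rewrite /w /=; case: eqP => //=; case: eqP.
rewrite multilinearD !wE !multilinearD -!wE.
rewrite (aT (v := [eta [eta v with i |-> v i] with j |-> v i]) ij); last first.
  by rewrite /= !eqxx (negPf ij).
rewrite (aT (v := [eta [eta v with i |-> v j] with j |-> v j]) ij); last first.
  by rewrite /= !eqxx (negPf ij).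
rewrite add0r addr0 !upd_same => /eqP; rewrite addr_eq0 => /eqP <-.
congr T; apply/funext => l /=.
case: tpermP => [->|->|/eqP/negPf-> /eqP/negPf->//]; last by rewrite eqxx.
by rewrite (negPf ij) eqxx.
Qed.

Lemma alternating_perm v (s : 'S_k) : T (v \o s) = (-1) ^+ s * T v.
Proof.
have [ts -> dts] := prod_tpermP s.
elim: ts v dts => [|t ts IH] v /=.
  move=> _; rewrite big_nil odd_perm1 mul1r; congr T.
  by apply/funext => i /=; rewrite perm1.
move=> /andP[dt dts]; rewrite big_cons odd_mul_tperm dt signr_addb -mulrA.
rewrite -IH // expr1 mulN1r -(alternating_swap _ dt); congr T.
by apply/funext => i /=; rewrite permM.
Qed.

End Multilinear.

(** Exchanging two equal arguments gives [T v = - T v], and 2 is invertible in [R]. *)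
Lemma antisym_alternating k (T : ('I_k -> V) -> R) :
  (forall v (s : 'S_k), T (v \o s) = (-1) ^+ s * T v) -> alternating T.
Proof.
move=> aT v i j ij vij; have := aT v (tperm i j).
have -> : v \o tperm i j = v.
  by apply/funext => l /=; case: tpermP => // ->.
rewrite odd_tperm ij expr1 mulN1r => /eqP.
by rewrite -addr_eq0 -mulr2n mulrn_eq0 /= => /eqP.
Qed.

(** Encoded with [unlift ord0] to match [v \o lift i], which is the family of arguments with the
    i-th one omitted. *)
Definition vcons k (u : V) (w : 'I_k -> V) : 'I_k.+1 -> V :=
  fun i => oapp w u (unlift ord0 i).

Lemma vcons0 k u (w : 'I_k -> V) : vcons u w ord0 = u.
Proof. by rewrite /vcons unlift_none. Qed.

Lemma vconsS k u (w : 'I_k -> V) j : vcons u w (lift ord0 j) = w j.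
Proof. by rewrite /vcons liftK. Qed.

Lemma eq_vcons k u (w : 'I_k -> V) f :
  f ord0 = u -> (forall j, f (lift ord0 j) = w j) -> f = vcons u w.
Proof.
by move=> f0 fS; apply/funext => i; rewrite /vcons; case: unliftP => [j|] ->.
Qed.

Lemma vcons_upd0 k u u' (w : 'I_k -> V) :
  [eta vcons u w with ord0 |-> u'] = vcons u' w :> ('I_k.+1 -> V).
Proof. by apply: eq_vcons => [|j] /=; rewrite ?eqxx // vconsS. Qed.

Lemma vcons_updS k u u' (w : 'I_k -> V) j :
  [eta vcons u w with lift ord0 j |-> u'] = vcons u [eta w with j |-> u'] :> ('I_k.+1 -> V).
Proof.
apply: eq_vcons => [|i] /=; first by rewrite vcons0.
by rewrite (inj_eq lift_inj) vconsS.
Qed.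

Lemma vcons_lift0 k u (w : 'I_k -> V) : vcons u w \o lift ord0 = w.
Proof. by apply/funext => j /=; rewrite vconsS. Qed.

Lemma vcons_liftS k u (w : 'I_k.+1 -> V) j :
  vcons u w \o lift (lift ord0 j) = vcons u (w \o lift j).
Proof.
apply: eq_vcons => [|i] /=.
  by rewrite (_ : lift _ _ = ord0) ?vcons0 //; apply/val_inj.
rewrite (_ : lift _ _ = lift ord0 (lift j i)) ?vconsS //.
by apply/val_inj; rewrite /= /bump /= !add1n ltnS addnS.
Qed.

(* Moving the i-th argument to the front costs i transpositions. *)
Lemma alternating_front k (T : ('I_k.+1 -> V) -> R) (v : 'I_k.+1 -> V) i u :
  multilinear T -> alternating T ->
  T (vcons u (v \o lift i)) = (-1) ^+ i * T [eta v with i |-> u].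
Proof.
move=> mT aT; have -> : vcons u (v \o lift i) =
    [eta v with i |-> u] \o lift_perm ord0 i 1.
  symmetry; apply: eq_vcons => [|j] /=; first by rewrite lift_perm_id eqxx.
  by rewrite lift_perm_lift perm1 eq_sym (negPf (neq_lift _ _)).
rewrite alternating_perm // odd_lift_perm odd_perm1 addbF /=.
by rewrite signr_odd.
Qed.

(** [lift_perm ord0 j t] sends [ord0] to j and acts as t on the remaining slots. Distinct pairs (j,
    t) give distinct permutations, and there are (k+1) k! of them. *)
Lemma sum_perm_first k (f : 'S_k.+1 -> R) :
  \sum_s f s = \sum_j \sum_t f (lift_perm ord0 j t).
Proof.
rewrite pair_big (reindex (fun p : 'I_k.+1 * 'S_k => lift_perm ord0 p.1 p.2)) //.
apply/onW_bij/inj_card_bij => [[i s] [j t] /= st|]; last first.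
  by rewrite card_prod card_ord !card_Sn.
have ij : i = j by rewrite -(lift_perm_id ord0 i s) st lift_perm_id.
rewrite -{}ij in st *; congr pair; apply/permP => l; apply: (@lift_inj _ i).
by rewrite -!(lift_perm_lift ord0) st.
Qed.

Lemma sum_perm_fix0 k (f : 'S_k.+1 -> R) :
  \sum_(s : 'S_k.+1 | s ord0 == ord0) f s = \sum_t f (lift_perm ord0 ord0 t).
Proof.
rewrite big_mkcond sum_perm_first (bigD1 ord0) //= [X in _ + X]big1 ?addr0.
  by apply: eq_bigr => t _; rewrite lift_perm_id eqxx.
by move=> j /negPf j0; apply: big1 => t _; rewrite lift_perm_id j0.
Qed.

Definition alt k (T : ('I_k -> V) -> R) (v : 'I_k -> V) : R :=
  \sum_(s : 'S_k) (-1) ^+ s * T (v \o s).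

Lemma alt_perm k (T : ('I_k -> V) -> R) v (s : 'S_k) :
  alt T (v \o s) = (-1) ^+ s * alt T v.
Proof.
rewrite /alt (reindex_inj (mulIg s^-1%g)) mulr_sumr; apply: eq_bigr => t _.
rewrite odd_permM odd_permV signr_addb mulrA [_ ^+ t * _]mulrC; congr (_ * T _).
by apply/funext => i /=; rewrite permM permKV.
Qed.

Lemma multilinear_alt k (T : ('I_k -> V) -> R) :
  multilinear T -> multilinear (alt T).
Proof.
move=> mT v i a u w; rewrite /alt mulr_sumr -big_split; apply: eq_bigr => s _ /=.
have updE x : [eta v with i |-> x] \o s = [eta v \o s with s^-1%g i |-> x].
  by apply/funext => j /=; rewrite -(inj_eq (@perm_inj _ s)) permKV.
by rewrite !updE mT mulrDr mulrCA.
Qed.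

Definition tens p q (S : ('I_p -> V) -> R) (T : ('I_q -> V) -> R) :
    ('I_(p + q) -> V) -> R :=
  fun v => S (v \o @lshift p q) * T (v \o @rshift p q).

Lemma wedgeE p q (S : tensor V p) (T : tensor V q) x v :
  wedge S T x v = (p`! * q`!)%:R^-1 * alt (tens (S x) (T x)) v.
Proof. by congr (_ * _); apply: eq_bigr => s _; rewrite mulrA. Qed.

Lemma multilinear_tens p q (S : ('I_p -> V) -> R) (T : ('I_q -> V) -> R) :
  multilinear S -> multilinear T -> multilinear (tens S T).
Proof.
move=> mS mT v i a u w; rewrite /tens; case: (split_ordP i) => j -> {i}.
  have lE x : [eta v with lshift q j |-> x] \o @lshift p q =
      [eta v \o @lshift p q with j |-> x].
    by apply/funext => l /=; rewrite eq_shift.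
  have rE x : [eta v with lshift q j |-> x] \o @rshift p q = v \o @rshift p q.
    by apply/funext => l /=; rewrite eq_shift.
  by rewrite !lE !rE mS mulrDl mulrA.
have lE x : [eta v with rshift p j |-> x] \o @lshift p q = v \o @lshift p q.
  by apply/funext => l /=; rewrite eq_shift.
have rE x : [eta v with rshift p j |-> x] \o @rshift p q =
    [eta v \o @rshift p q with j |-> x].
  by apply/funext => l /=; rewrite eq_shift.
by rewrite !lE !rE mT mulrDr mulrCA.
Qed.

Lemma multilinear_wedge p q (S : tensor V p) (T : tensor V q) x :
  multilinear (S x) -> multilinear (T x) -> multilinear (wedge S T x).
Proof.
move=> mS mT v i a u w; rewrite !wedgeE (multilinear_alt (multilinear_tens mS mT)).
by rewrite mulrDr mulrCA.
Qed.

Lemma alternating_wedge p q (S : tensor V p) (T : tensor V q) x :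
  alternating (wedge S T x).
Proof.
by apply: antisym_alternating => v s; rewrite !wedgeE alt_perm mulrCA.
Qed.

(** Permutations are grouped by the argument that goes to [S]. Since [T] is alternating, the q!
    terms of a group are equal, which cancels the normalization 1/(1! q!). *)
Lemma wedge1E q (S : tensor V 1) (T : tensor V q) x v :
  multilinear (T x) -> alternating (T x) ->
  wedge S T x v =
  \sum_(i < q.+1) (-1) ^+ i * (S x (fun=> v i) * T x (v \o lift (i : 'I_q.+1))).
Proof.
move=> mT aT; rewrite wedgeE /alt sum_perm_first mulr_sumr; apply: eq_bigr => i _.
rewrite (eq_bigr (fun=> (-1) ^+ i * (S x (fun=> v i) * T x (v \o lift (i : 'I_q.+1))))).
  by rewrite sumr_const card_Sn mul1n -[X in _ * X]mulr_natl mulKf // pnatr_eq0 -lt0n fact_gt0.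
move=> t _; rewrite odd_lift_perm /= signr_addb signr_odd /tens.
have -> : (v \o lift_perm ord0 i t) \o @lshift 1 q = fun=> v i.
  apply/funext => j /=; rewrite (_ : lshift q j = ord0) ?lift_perm_id //.
  by apply/val_inj; rewrite /= ord1.
have -> : (v \o lift_perm ord0 i t) \o @rshift 1 q = (v \o lift i) \o t.
  apply/funext => j /=; rewrite -(lift_perm_lift ord0); congr (v (lift_perm _ _ _ _)).
  exact/val_inj.
by rewrite alternating_perm // -!mulrA; congr (_ * _); rewrite mulrCA signrMK.
Qed.

End AlternatingForms.

(** * Powers of a constant 2-form *)

Section PowersOfTwoForms.
Context {R : realType} {V : normedModType R}.

(** Lets the permutations of the last q slots act on the second factor of a tensor product whose
    first factor is a 2-form. *)
Definition lift_perm2 q (t : 'S_q) : 'S_(2 + q) :=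
  lift_perm ord0 ord0 (lift_perm ord0 ord0 t).

Lemma rshift2E q (j : 'I_q) : rshift 2 j = lift ord0 (lift ord0 j).
Proof. exact/val_inj. Qed.

Lemma lshift2E q (i : 'I_2) :
  lshift q i = if i == ord0 then ord0 else lift ord0 ord0.
Proof. by apply/val_inj; case: i => [[|[|//]] hi]. Qed.

Lemma lift_perm2_rshift q (t : 'S_q) j :
  lift_perm2 t (rshift 2 j) = rshift 2 (t j).
Proof. by rewrite !rshift2E !lift_perm_lift. Qed.

Lemma lift_perm2_lshift q (t : 'S_q) i : lift_perm2 t (lshift q i) = lshift q i.
Proof.
rewrite lshift2E; case: ifP => _; rewrite /lift_perm2 ?lift_perm_id //.
by rewrite lift_perm_lift lift_perm_id.
Qed.

Lemma odd_lift_perm2 q (t : 'S_q) : lift_perm2 t = t :> bool.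
Proof. by rewrite !odd_lift_perm. Qed.

(** Each permutation t of the inner sum is absorbed by the outer one through the substitution of
    [lift_perm2 t * s] for s, with matching signs; this leaves q! equal terms. *)
Lemma alt_tens_alt q (S : ('I_2 -> V) -> R) (T : ('I_q -> V) -> R) v :
  alt (tens S (alt T)) v = q`!%:R * alt (tens S T) v.
Proof.
rewrite /alt /tens.
under eq_bigr do rewrite mulr_sumr mulr_sumr.
rewrite exchange_big /= (eq_bigr (fun=> alt (tens S T) v)); last first.
  move=> t _; rewrite [RHS](reindex_inj (mulgI (lift_perm2 t))); apply: eq_bigr => s _.
  rewrite odd_permM odd_lift_perm2 signr_addb /tens !mulrA [X in X * _]mulrAC.
  rewrite [_ ^+ s * _]mulrC.
  congr (_ * S _ * T _); apply/funext => j /=; rewrite permM.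
    by rewrite lift_perm2_lshift.
  by rewrite lift_perm2_rshift.
by rewrite sumr_const card_Sn -[_ *+ _]mulr_natl.
Qed.

Variable w : ('I_2 -> V) -> R.
Hypothesis mw : multilinear w.
Hypothesis aw : alternating w.

Fixpoint tens_pow k : ('I_k.*2 -> V) -> R :=
  if k is k'.+1 then tens w (@tens_pow k') else fun=> 1.

(** Each wedge divides by 2! (2k)!, and [alt_tens_alt] cancels the factor (2k)!; one factor 1/2
    remains for each copy of [w]. *)
Lemma wedge_powE k x v :
  wedge_pow (fun=> w) k x v = (2 ^+ k)^-1 * alt (@tens_pow k) v.
Proof.
elim: k v => [|k IH] v.
  rewrite expr0 invr1 mul1r /alt (eq_bigr (fun=> 1)).
    by rewrite sumr_const card_Sn.
  by move=> s _; rewrite (_ : s = 1%g) ?odd_perm1 ?mulr1 //; apply/permP => -[].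
rewrite /= wedgeE.
have -> : wedge_pow (fun=> w) k x = fun v => (2 ^+ k)^-1 * alt (@tens_pow k) v.
  exact/funext.
have -> : tens w (fun u => (2 ^+ k)^-1 * alt (@tens_pow k) u) =
    fun u => (2 ^+ k)^-1 * tens w (alt (@tens_pow k)) u.
  by apply/funext => u; rewrite /tens mulrCA.
have -> u : alt (fun u => (2 ^+ k)^-1 * tens w (alt (@tens_pow k)) u) u =
    (2 ^+ k)^-1 * alt (tens w (alt (@tens_pow k))) u.
  by rewrite /alt mulr_sumr; apply: eq_bigr => s _; rewrite mulrCA.
rewrite alt_tens_alt natrM invfM exprS invfM !mulrA; congr (_ * _).
by rewrite -!mulrA; congr (_ * _); rewrite mulrCA mulVf ?mulr1.
Qed.

Lemma tens_pow_swap k (v : 'I_(2 + k.*2) -> V) :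
  tens_pow (k := k.+1)
    (v \o tperm (lshift k.*2 (ord0 : 'I_2)) (lshift k.*2 ord_max)) =
  - tens_pow (k := k.+1) v.
Proof.
rewrite /= /tens -mulNr; congr (_ * _).
  rewrite -(alternating_swap mw aw _ (i := ord0) (j := ord_max)) //; congr w.
  apply/funext => i /=; congr (v _).
  by rewrite -(inj_tperm _ _ _ (@lshift_inj _ _)).
congr tens_pow; apply/funext => i /=.
by rewrite tpermD // eq_shift.
Qed.

Lemma tens_pow_lift k (p : 'S_k.*2) (v : 'I_(2 + k.*2) -> V) :
  (forall v, tens_pow (v \o p) = (-1) ^+ p * tens_pow v) ->
  tens_pow (k := k.+1) (v \o lift_perm2 p) =
  (-1) ^+ lift_perm2 p * tens_pow (k := k.+1) v.
Proof.
move=> hp; rewrite odd_lift_perm2 /= /tens mulrCA -hp.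
congr (w _ * @tens_pow k _); apply/funext => i /=.
  by rewrite lift_perm2_lshift.
by rewrite lift_perm2_rshift.
Qed.

(** Exchanges the first two factors of [tens_pow]; it is even, in accordance with the fact that
    2-forms commute. *)
Definition pair_swap q : 'S_(2 + (2 + q)) :=
  (tperm (lshift _ ord0) (rshift 2 (lshift _ ord0)) *
   tperm (lshift _ ord_max) (rshift 2 (lshift _ ord_max)))%g.

Lemma pair_swapE q :
  [/\ pair_swap q = false :> bool,
      forall i, pair_swap q (lshift _ i) = rshift 2 (lshift _ i),
      forall i, pair_swap q (rshift 2 (lshift _ i)) = lshift _ i &
      forall i, pair_swap q (rshift 2 (rshift 2 i)) = rshift 2 (rshift 2 i)].
Proof.
have I2 (i : 'I_2) : i = ord0 \/ i = ord_max.
  by case: i => [[|[|//]] hi]; [left|right]; apply/val_inj.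
split=> [|i|i|i]; first by rewrite odd_permM !odd_tperm !eq_shift.
- rewrite permM; case: (I2 i) => ->; first by rewrite tpermL tpermD ?eq_shift.
  by rewrite (@tpermD _ (lshift _ ord0)) ?eq_shift // tpermL.
- rewrite permM; case: (I2 i) => ->; first by rewrite tpermR tpermD ?eq_shift.
  by rewrite (@tpermD _ (lshift _ ord0)) ?eq_shift // tpermR.
- by rewrite permM !tpermD ?eq_shift.
Qed.

Lemma tens_pow_pair_swap k (v : 'I_(2 + (2 + k.*2)) -> V) :
  tens_pow (k := k.+2) (v \o pair_swap k.*2) = tens_pow (k := k.+2) v.
Proof.
have [_ s1 s2 s3] := pair_swapE k.*2.
rewrite /= /tens mulrCA; congr (w _ * (w _ * @tens_pow k _)); apply/funext => i /=.
- by rewrite s2.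
- by rewrite s1.
- by rewrite s3.
Qed.

(** Within the first pair, the identity and the swap of the two slots suffice; [w] turns the swap
    into a sign. *)
Lemma tens_pow_first_pair k (i : 'I_2) :
  exists p : 'S_(2 + k.*2), p ord0 = lshift k.*2 i /\
    forall v, tens_pow (k := k.+1) (v \o p) = (-1) ^+ p * tens_pow (k := k.+1) v.
Proof.
case: (boolP (i == ord0)) => [/eqP->|i0].
  exists 1%g; split=> [|v]; first by rewrite perm1; apply/val_inj.
  rewrite odd_perm1 mul1r; congr tens_pow.
  by apply/funext => l /=; rewrite perm1.
have -> : i = ord_max by case: i i0 => [[|[|//]] hi] h; apply/val_inj.
exists (tperm (lshift k.*2 (ord0 : 'I_2)) (lshift k.*2 ord_max)); split=> [|v].
  rewrite -[RHS](tpermL (lshift _ (ord0 : 'I_2))); congr (tperm _ _ _).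
  exact/val_inj.
by rewrite odd_tperm eq_shift expr1 mulN1r tens_pow_swap.
Qed.

(* The group of signed symmetries of [tens_pow] is transitive on the slots. *)
Lemma tens_pow_transitive k (j : 'I_k.+1.*2) :
  exists p : 'S_k.+1.*2, p ord0 = j /\
    forall v, tens_pow (v \o p) = (-1) ^+ p * tens_pow v.
Proof.
elim: k j => [|k IH] j; case: (@split_ordP 2 _ j) => i ->.
- exact (tens_pow_first_pair 0 i).
- by case: i.
- exact (tens_pow_first_pair k.+1 i).
have [p [p0 hp]] := IH i.
have [s0 s1 s2 s3] := pair_swapE k.*2.
(* Products of permutations act from left to right: [pair_swap] brings [ord0] to the head of the
   second factor, and [p] carries it on to the wanted slot of the tail. *)
exists (pair_swap k.*2 * lift_perm2 p)%g; split.
  transitivity (lift_perm2 p (pair_swap _ (lshift _ ord0))).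
    by rewrite permM; congr (lift_perm2 _ (pair_swap _ _)); apply/val_inj.
  rewrite s1 -p0 -lift_perm2_rshift; congr (lift_perm2 _ (rshift _ _)).
  exact/val_inj.
move=> v; have -> : v \o (pair_swap k.*2 * lift_perm2 p)%g =
    (v \o lift_perm2 p) \o pair_swap k.*2.
  by apply/funext => l /=; rewrite permM.
rewrite odd_permM s0 addFb; etransitivity; first exact: tens_pow_pair_swap.
exact: tens_pow_lift.
Qed.

(** Permutations are grouped by the tensor slot that receives the argument [v ord0]. By transitivity
    of the signed symmetries, all 2(k+1) groups contribute the same as that of slot [ord0]. *)
Lemma alt_tens_powS k v :
  alt (@tens_pow k.+1) v = k.+1.*2%:R *
    \sum_(s : 'S_k.+1.*2 | s ord0 == ord0) (-1) ^+ s * tens_pow (v \o s).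
Proof.
rewrite /alt (partition_big (fun s : 'S_k.+1.*2 => s^-1%g ord0) predT) //=.
set F := BIG_F; rewrite (eq_bigr (fun=> F ord0)) {}/F; last first.
  move=> j _; have [p [p0 hp]] := tens_pow_transitive j.
  rewrite (reindex_inj (mulgI p^-1%g)).
  apply: eq_big => [s|s _].
    by rewrite invMg invgK permM -p0 (inj_eq perm_inj).
  rewrite odd_permM odd_permV signr_addb -mulrA mulrCA; congr (_ * _).
  rewrite -hp; congr tens_pow.
  by apply/funext => l /=; rewrite permM permK.
rewrite sumr_const card_ord -[_ *+ _]mulr_natl; congr (_ * _).
apply: eq_bigl => s; by rewrite -(inj_eq (@perm_inj _ s)) permKV eq_sym.
Qed.

(** This is the contraction formula i_u w^(k+1) = (k+1) (i_u w) /\ w^k. Its coefficient is the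
    2(k+1) of [alt_tens_powS] times the additional 1/2 of [wedge_powE]. *)
Lemma wedge_powS k x (v : 'I_k.+1.*2 -> V) :
  wedge_pow (fun=> w) k.+1 x v = k.+1%:R *
    \sum_(j < k.*2.+1) (-1) ^+ j * (w (vec2 (v ord0) (v (lift ord0 j))) *
      wedge_pow (fun=> w) k x (v \o lift ord0 \o lift j)).
Proof.
rewrite wedge_powE alt_tens_powS sum_perm_fix0 sum_perm_first.
rewrite (_ : k.+1.*2%:R = k.+1%:R * 2 :> R) ?mulrA; last by rewrite -natrM muln2.
have coef (x1 x2 x3 : R) : 2^-1 * x1 * x2 * 2 * x3 = x2 * (x1 * x3) by field.
rewrite exprS invfM coef; congr (_ * _); rewrite mulr_sumr.
apply: eq_bigr => j _; rewrite wedge_powE [w _ * _]mulrCA [RHS]mulrCA; congr (_ * _).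
rewrite mulrA mulr_sumr; apply: eq_bigr => t _.
rewrite !odd_lift_perm /= signr_addb signr_odd -!mulrA; congr (_ * _).
rewrite mulrCA /= /tens; congr (w _ * (_ * @tens_pow k _)).
  apply/funext => i; rewrite /= lshift2E /vec2; case: ifP => _.
    by rewrite lift_perm_id.
  by rewrite lift_perm_lift lift_perm_id.
by apply/funext => i; rewrite /= rshift2E !lift_perm_lift.
Qed.

Lemma multilinear_wedge_pow k x : multilinear (wedge_pow (fun=> w) k x).
Proof.
elim: k => [|k IH] /=; first by move=> v [].
exact (multilinear_wedge (S := fun=> w) mw IH).
Qed.

Lemma alternating_wedge_pow k x : alternating (wedge_pow (fun=> w) k x).
Proof. by case: k => [|k] /=; [move=> v []|apply (@alternating_wedge _ _ 2)]. Qed.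

End PowersOfTwoForms.

(** * Top forms, the complex structure and the Kaehler form on the space of matrices *)

Section MatrixSpace.
Context {R : realType} {d : nat}.
Local Notation V := 'M[R]_d.+1.
Implicit Types X Y : V.

(** More than dim V vectors satisfy a nontrivial linear relation. Substituted into a slot of nonzero
    coefficient, it leaves only that coefficient times [T v]. *)
Lemma alternating_overflow k (T : ('I_k -> V) -> R) v :
  multilinear T -> alternating T -> (d.+1 * d.+1 < k)%N -> T v = 0.
Proof.
move=> mT aT dk; pose M := \matrix_i mxvec (v i).
have : kermx M != 0.
  rewrite kermx_eq0 /row_free; apply: contraTneq dk => <-.
  by rewrite -leqNgt rank_leq_col.
case/rowV0Pn => c /sub_kermxP cM c0.
have [i ci] : exists i, c 0 i != 0.
  apply/existsP; apply: contraNT c0; rewrite negb_exists => /forallP c0.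
  by apply/eqP/rowP => i; rewrite mxE; apply/eqP; rewrite -[_ == _]negbK c0.
have cv : \sum_j c 0 j *: v j = 0.
  apply/(can_inj mxvecK); rewrite linear0 -[RHS]cM linear_sum /=.
  apply/rowP => l; rewrite mxE summxE; apply: eq_bigr => j _.
  by rewrite linearZ !mxE.
have := multilinear0 mT v i; rewrite -cv multilinear_sum // (bigD1 i) //=.
rewrite multilinearZ // upd_same big1 ?addr0 => [/eqP|j ji].
  by rewrite mulf_eq0 (negPf ci) => /eqP.
rewrite multilinearZ // (aT _ i j) ?mulr0 //; first by rewrite eq_sym.
by rewrite /= eqxx (negPf ji).
Qed.

Section TopForm.
Variables (q : nat) (O : ('I_q.+1 -> V) -> R).
Hypotheses (mO : multilinear O) (aO : alternating O).
Hypothesis dq : (d.+1 * d.+1 <= q.+1)%N.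

(* A form of degree dim V + 1 vanishes, in particular [wedge l O] for the
   coordinate form [l]. *)
Lemma top_form_wedge1 (v : 'I_q.+2 -> V) r s :
  \sum_(i < q.+2) (-1) ^+ i * (v i r s * O (v \o lift i)) = 0.
Proof.
pose S : tensor V 1 := fun _ u => u ord0 r s.
pose T : tensor V q.+1 := fun _ => O.
have mS : multilinear (S 0).
  by move=> u i a x y; rewrite ord1 /S /= !mxE.
rewrite -(wedge1E S (T := T) (x := 0) v mO aO).
apply: (@alternating_overflow (1 + q.+1) (wedge S T 0)) => //.
  exact: multilinear_wedge.
exact: alternating_wedge.
Qed.

(** Each [A (v j)] is expanded in the basis [delta_mx a b]. For fixed (a, b), [top_form_wedge1] on
    the arguments [A (delta_mx a b)] and [v] extracts the diagonal coefficient of [A] times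
    [O v]. *)
Lemma top_form_trace (A : {linear V -> V}) v :
  \sum_j O [eta v with j |-> A (v j)] =
  (\sum_a \sum_b A (delta_mx a b) a b) * O v.
Proof.
transitivity (\sum_a \sum_b \sum_(j < q.+1)
    (-1) ^+ j * (v j a b * O (vcons (A (delta_mx a b)) (v \o lift j)))).
  under [RHS]eq_bigr do rewrite exchange_big /=.
  rewrite exchange_big; apply: eq_bigr => j _ /=.
  rewrite [in LHS](matrix_sum_delta (v j)) linear_sum multilinear_sum //.
  apply: eq_bigr => a _; rewrite linear_sum multilinear_sum //.
  apply: eq_bigr => b _; rewrite linearZ multilinearZ // alternating_front //.
  by rewrite [v j a b * (_ * _)]mulrCA signrMK.
rewrite mulr_suml; apply: eq_bigr => a _; rewrite mulr_suml.
apply: eq_bigr => b _; have := top_form_wedge1 (vcons (A (delta_mx a b)) v) a b.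
rewrite big_ord_recl vcons0 vcons_lift0 mul1r => /eqP; rewrite addr_eq0 => /eqP ->.
rewrite -sumrN; apply: eq_bigr => j _.
by rewrite vconsS vcons_liftS lift0 exprS mulN1r mulNr opprK.
Qed.

End TopForm.

(** The terms of [top_form_wedge1] that belong to the arguments [X] and [Y] are moved to the other
    side. *)
Lemma top_form_wedge1_vcons k (O : ('I_k.+2 -> V) -> R) (w : 'I_k.+1 -> V) X Y r s :
  multilinear O -> alternating O -> (d.+1 * d.+1 <= k.+2)%N ->
  \sum_(i < k.+1) (-1) ^+ i * (w i r s * O (vcons X (vcons Y (w \o lift i)))) =
  Y r s * O (vcons X w) - X r s * O (vcons Y w).
Proof.
move=> mO aO dk; have := top_form_wedge1 mO aO dk (vcons X (vcons Y w)) r s.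
rewrite 2!big_ord_recl vcons_lift0 vcons_liftS vcons_lift0 !vconsS !vcons0.
rewrite mul1r expr1 mulN1r => E.
set S := LHS; suff : X r s * O (vcons Y w) + (- (Y r s * O (vcons X w)) + S) = 0.
  by move: S => S; lra.
rewrite -E; congr (_ + (_ + _)); apply: eq_bigr => i _.
by rewrite !lift0 !exprS !mulN1r opprK !vconsS !vcons_liftS.
Qed.

(** The column with the other half of the same complex coordinate. For odd d the index stays in
    range, so [inord] never falls back on its default value. *)
Definition conj_index (k : 'I_d.+1) : 'I_d.+1 :=
  if odd k then inord k.-1 else inord k.+1.

Definition conj_sign (k : 'I_d.+1) : R := if odd k then -1 else 1.

Lemma JmulE X i k : Jmul X i k = conj_sign k * X i (conj_index k).
Proof.
by rewrite /Jmul mxE /conj_sign /conj_index; case: ifP => _; rewrite ?mulN1r ?mul1r.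
Qed.

Lemma conj_sign_sqr k : conj_sign k * conj_sign k = 1.
Proof. by rewrite /conj_sign; case: ifP => _; rewrite ?mulrNN mulr1. Qed.

(** As a right multiplication by a constant matrix, J commutes with left multiplications, and thus
    with the coframe. *)
Lemma Jmul_mulmx X : Jmul X = X *m Jmul 1%:M.
Proof.
apply/matrixP => i k; rewrite [RHS]mxE (bigD1 (conj_index k)) //= big1 ?addr0.
  by rewrite !JmulE mxE eqxx mulr1 mulrC.
by move=> j /negPf jk; rewrite JmulE mxE jk !mulr0.
Qed.

Lemma Jmul_linear : linear (@Jmul R d).
Proof. by move=> a X Y; rewrite Jmul_mulmx mulmxDl -scalemxAl -!Jmul_mulmx. Qed.

HB.instance Definition _ := GRing.isLinear.Build R V V *:%R (@Jmul R d) Jmul_linear.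

Lemma Jmul_mulmxl (A : V) X : Jmul (A *m X) = A *m Jmul X.
Proof. by rewrite (Jmul_mulmx X) mulmxA; apply: Jmul_mulmx. Qed.

Definition frob X Y : R := \sum_i \sum_k X i k * Y i k.

Lemma frobC X Y : frob X Y = frob Y X.
Proof. by apply: eq_bigr => i _; apply: eq_bigr => k _; rewrite mulrC. Qed.

Lemma frobDl a X X' Y : frob (a *: X + X') Y = a * frob X Y + frob X' Y.
Proof.
rewrite /frob mulr_sumr -big_split; apply: eq_bigr => i _.
rewrite mulr_sumr -big_split; apply: eq_bigr => k _.
by rewrite !mxE mulrDl mulrA.
Qed.

Lemma frobDr a X X' Y : frob Y (a *: X + X') = a * frob Y X + frob Y X'.
Proof. by rewrite !(frobC Y) frobDl. Qed.

Lemma frob_gt0 X : X != 0 -> 0 < frob X X.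
Proof.
move=> X0; have ge0 i k : 0 <= X i k * X i k by rewrite -expr2 sqr_ge0.
rewrite lt0r; apply/andP; split; last by do 2!apply: sumr_ge0 => ? _.
apply: contraNneq X0 => /eqP; rewrite psumr_eq0; last first.
  by move=> i _; apply: sumr_ge0.
move=> /allP Z; apply/eqP/matrixP => i k; rewrite mxE.
have := Z i (mem_index_enum _); rewrite psumr_eq0 // => /allP/(_ k (mem_index_enum _)).
by rewrite mulf_eq0 orbb => /eqP.
Qed.

Lemma frob_deltal a b X : frob (delta_mx a b) X = X a b.
Proof.
rewrite /frob (bigD1 a) //= (bigD1 b) //= !mxE !eqxx mul1r.
rewrite !big1 ?addr0 // => [i /negPf ia|k /negPf kb].
  by apply: big1 => k _; rewrite !mxE ia mul0r.
by rewrite !mxE kb andbF mul0r.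
Qed.

Hypothesis od : odd d.

Lemma conj_indexE (k : 'I_d.+1) :
  conj_index k = (if odd k then k.-1 else k.+1) :> nat.
Proof.
rewrite /conj_index; case: ifP => ok; rewrite inordK //.
  by apply: leq_ltn_trans (leq_pred _) _.
have := ltn_ord k; rewrite ltnS leq_eqVlt => /orP[/eqP kd|//].
by rewrite kd od in ok.
Qed.

Lemma odd_conj_index k : odd (conj_index k) = ~~ odd k.
Proof.
rewrite conj_indexE; case: ifP => /= ok; last by rewrite ok.
by case: (k : nat) ok => //= n /negbTE.
Qed.

Lemma conj_indexK : involutive conj_index.
Proof.
move=> k; apply/val_inj; rewrite /= !conj_indexE -conj_indexE odd_conj_index.
rewrite conj_indexE; case: (boolP (odd k)) => //= ok.
by case: (k : nat) ok => //=.
Qed.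

Lemma conj_signN k : conj_sign (conj_index k) = - conj_sign k.
Proof. by rewrite /conj_sign odd_conj_index if_neg; case: ifP; rewrite ?opprK. Qed.

Lemma JmulK X : Jmul (Jmul X) = - X.
Proof.
apply/matrixP => i k; rewrite JmulE JmulE conj_indexK conj_signN !mxE mulrA.
by rewrite mulrN conj_sign_sqr mulN1r.
Qed.

Lemma Jmul_delta a b :
  Jmul (delta_mx a b) = - conj_sign b *: delta_mx a (conj_index b).
Proof.
apply/matrixP => i k; rewrite JmulE !mxE (can2_eq conj_indexK conj_indexK).
by case: (k =P conj_index b) => [->|]; rewrite ?conj_signN // !andbF !mulr0.
Qed.

Lemma frob_Jmul X Y : frob (Jmul X) (Jmul Y) = frob X Y.
Proof.
apply: eq_bigr => i _; rewrite [RHS](reindex_inj (can_inj conj_indexK)).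
by apply: eq_bigr => k _; rewrite !JmulE mulrACA conj_sign_sqr mul1r.
Qed.

Lemma frobNl X Y : frob (- X) Y = - frob X Y.
Proof.
by rewrite /frob -sumrN; apply: eq_bigr => i _; rewrite -sumrN;
  apply: eq_bigr => k _; rewrite mxE mulNr.
Qed.

(** J is an isometry of square -1, hence skew. *)
Lemma frob_JmulC X Y : frob (Jmul X) Y = - frob (Jmul Y) X.
Proof. by rewrite -frob_Jmul JmulK frobNl frobC. Qed.

(** Fundamental form of the Euclidean metric [frob]; composed with the coframe, it becomes that of
    the invariant metric. *)
Definition kahler (v : 'I_2 -> V) : R := frob (Jmul (v ord0)) (v ord_max).

Lemma multilinear_kahler : multilinear kahler.
Proof.
move=> v i a u w; rewrite /kahler /=.
have [->|->] : i = ord0 \/ i = ord_max.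
  by case: i => [[|[|//]] hi]; [left|right]; apply/val_inj.
- by rewrite !eqxx linearP frobDl.
- by rewrite !eqxx /= frobDr.
Qed.

Lemma alternating_kahler : alternating kahler.
Proof.
move=> v i j ij vij; have v01 : v ord0 = v ord_max.
  by case: i j ij vij => [[|[|//]] hi] [[|[|//]] hj] // _ vij; [|symmetry];
    (etransitivity; first (etransitivity; last exact: vij)); congr v; apply/val_inj.
have /eqP := frob_JmulC (v ord0) (v ord0).
by rewrite -addr_eq0 -mulr2n mulrn_eq0 /kahler -v01 => /eqP.
Qed.

Local Notation W k := (wedge_pow (fun=> kahler) k (0 : V)).

Lemma kahler_vec2 X Y : kahler (vec2 X Y) = frob (Jmul X) Y.
Proof. by []. Qed.

(** The bivector sum_e e /\ J e inverts [kahler]: the coefficients are the coordinates of [- Jmul Y]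
    in an orthonormal basis, and J carries this vector back to [Y]. *)
Lemma sum_kahler_delta Y :
  \sum_a \sum_b kahler (vec2 (delta_mx a b) Y) *: Jmul (delta_mx a b) = Y.
Proof.
have {2}-> : Y = Jmul (- Jmul Y) by rewrite linearN /= JmulK opprK.
rewrite [in RHS](matrix_sum_delta (- Jmul Y)) linear_sum.
apply: eq_bigr => a _; rewrite linear_sum; apply: eq_bigr => b _.
by rewrite linearZ /= kahler_vec2 frob_JmulC frobC frob_deltal [in RHS]mxE.
Qed.

(* This is the contraction of [kahler ^ (k + 1)] with the dual bivector of
   [kahler]; the coefficient is the commutator of the Lefschetz operators. *)
Lemma kahler_pow_contraction k (w : 'I_k.*2 -> V) :
  \sum_a \sum_b W k.+1 (vcons (delta_mx a b) (vcons (Jmul (delta_mx a b)) w)) =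
  k.+1%:R * ((d.+1 * d.+1)%:R - k.*2%:R) * W k w.
Proof.
have mK := multilinear_kahler; have aK := alternating_kahler.
(* In the expansion along the first argument, [delta_mx a b] pairs to 1 with its partner
   [Jmul (delta_mx a b)]; the other terms pair it with some [w j]. *)
transitivity (\sum_a \sum_b k.+1%:R * (W k w - \sum_(j < k.*2) (-1) ^+ j *
   (kahler (vec2 (delta_mx a b) (w j)) *
    W k ((vcons (Jmul (delta_mx a b)) w) \o lift (lift ord0 j))))).
  apply: eq_bigr => a _; apply: eq_bigr => b _.
  rewrite wedge_powS //; congr (_ * _).
  rewrite big_ord_recl !vcons_lift0 vcons0 vconsS vcons0 mul1r kahler_vec2.
  rewrite frob_Jmul frob_deltal mxE !eqxx mul1r -sumrN; congr (_ + _).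
  apply: eq_bigr => j _.
  by rewrite lift0 exprS mulN1r mulNr !vconsS.
rewrite -mulrA; under eq_bigr do rewrite -mulr_sumr.
rewrite -mulr_sumr; congr (_ * _).
under eq_bigr do rewrite sumrB sumr_const card_ord.
rewrite sumrB sumr_const card_ord -mulrnA -[_ *+ _]mulr_natl mulrBl; congr (_ - _).
under eq_bigr do rewrite exchange_big /=.
(* By [sum_kahler_delta] the sum over a and b puts [w j] back in its place, so each of the 2k terms
   equals [W k w]. *)
rewrite exchange_big (eq_bigr (fun=> W k w)) /=; last first.
  move=> j _; case: k w j => [|k] w j; first by case: j.
  transitivity ((-1) ^+ j * W k.+1 (vcons (w j) (w \o lift j))).
    rewrite -[in RHS](sum_kahler_delta (w j)).
    rewrite -(vcons_upd0 0) multilinear_sum; last exact: multilinear_wedge_pow.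
    rewrite mulr_sumr; apply: eq_bigr => a _.
    rewrite multilinear_sum; last exact: multilinear_wedge_pow.
    rewrite mulr_sumr; apply: eq_bigr => b _; congr (_ * _).
    rewrite multilinearZ; last exact: multilinear_wedge_pow.
    by rewrite vcons_upd0 vcons_liftS.
  rewrite alternating_front ?signrMK ?upd_same //.
    exact (multilinear_wedge_pow mK (k := k.+1) (0 : V)).
  exact (alternating_wedge_pow kahler (k := k.+1) (0 : V)).
by rewrite sumr_const card_ord -[_ *+ _]mulr_natl.
Qed.

(** The quadratic expression of the structure equations, with entries [X i 0 * Y 0 k]. In [Y] it is
    left multiplication by a fixed matrix, so that [top_form_trace] applies. *)
Definition left_mu (X Y : V) : V := X *m delta_mx 0 0 *m Y.

Lemma left_muE X Y i k : left_mu X Y i k = X i 0 * Y 0 k.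
Proof.
rewrite /left_mu -mulmxA mxE (bigD1 0) //= big1 ?addr0 => [|j /negPf j0].
  rewrite mxE (bigD1 0) //= mxE !eqxx mul1r big1 ?addr0 // => l /negPf l0.
  by rewrite mxE l0 andbF mul0r.
by rewrite mxE big1 ?mulr0 // => l _; rewrite mxE j0 mul0r.
Qed.

Lemma left_mu_sum X Y : left_mu X Y = \sum_r X r 0 *: (delta_mx r 0 *m Y).
Proof.
apply/matrixP => i k; rewrite left_muE summxE (bigD1 i) //= big1 ?addr0.
  by rewrite !mxE (bigD1 0) //= !mxE !eqxx mul1r big1 ?addr0 // => l /negPf l0;
    rewrite mxE l0 andbF mul0r.
move=> r /negPf ri; rewrite !mxE big1 ?mulr0 // => l _.
by rewrite mxE eq_sym ri mul0r.
Qed.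

Lemma left_mu_trace X : \sum_a \sum_b left_mu X (delta_mx a b) a b = d.+1%:R * X 0 0.
Proof.
rewrite (bigD1 0) //= [X in _ + X]big1 ?addr0 => [|a /negPf a0].
  rewrite (eq_bigr (fun=> X 0 0)) => [|b _].
    by rewrite sumr_const card_ord -[_ *+ _]mulr_natl.
  by rewrite left_muE mxE !eqxx mulr1.
by apply: big1 => b _; rewrite left_muE mxE eq_sym a0 mulr0.
Qed.

Section Lee.
Variables (q : nat) (O : ('I_q.+2 -> V) -> R).
Hypotheses (mO : multilinear O) (aO : alternating O).
Hypothesis dq : (d.+1 * d.+1 <= q.+2)%N.

(** [top_form_trace] for the map [left_mu X'], with the terms of the first two slots moved to the
    right. *)
Lemma top_form_left_mu X Y X' (w : 'I_q -> V) :
  \sum_j O (vcons X (vcons Y [eta w with j |-> left_mu X' (w j)])) =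
  d.+1%:R * X' 0 0 * O (vcons X (vcons Y w)) -
  O (vcons (left_mu X' X) (vcons Y w)) - O (vcons X (vcons (left_mu X' Y) w)).
Proof.
have := top_form_trace mO aO dq (mulmx (X' *m delta_mx 0 0)) (vcons X (vcons Y w)).
rewrite left_mu_trace => <-; rewrite 2!big_ord_recl.
rewrite !vcons_updS !vcons_upd0 !vconsS !vcons0 -!/(left_mu _ _).
set S := LHS; suff -> : S = \sum_(j < q) O
    [eta vcons X (vcons Y w) with lift ord0 (lift ord0 j) |->
      left_mu X' (vcons X (vcons Y w) (lift ord0 (lift ord0 j)))] by lra.
by apply: eq_bigr => j _; rewrite !vcons_updS !vconsS.
Qed.

(** [delta_mx r 0 *m Y] is row 0 of [Y] moved to row r. If the common support is row 0, only r = 0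
    contributes; otherwise [X 0 0] and row 0 of [Y] vanish. *)
Lemma sum_row_delta X Y a (f : V -> R) :
  (forall i k, i != a -> X i k = 0) -> (forall i k, i != a -> Y i k = 0) ->
  f 0 = 0 -> \sum_r X r 0 * f (delta_mx r 0 *m Y) = X 0 0 * f Y.
Proof.
move=> hX hY f0; have YE r : delta_mx r 0 *m Y = \matrix_(i, k) (Y 0 k *+ (i == r)).
  apply/matrixP => i k; rewrite !mxE (bigD1 0) //= !mxE andbT mulr_natl.
  rewrite big1 ?addr0 // => l /negPf l0.
  by rewrite mxE l0 andbF mul0r.
have [a0|a0] := eqVneq a 0; last first.
  rewrite big1 ?hX ?mul0r 1?eq_sym // => r _.
  rewrite YE (_ : (\matrix_(_, _) _) = 0) ?f0 ?mulr0 //.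
  by apply/matrixP => i k; rewrite !mxE hY 1?eq_sym // mul0rn.
rewrite a0 in hX hY; rewrite (bigD1 0) //= big1 ?addr0 => [|r r0].
  congr (_ * f _); rewrite YE; apply/matrixP => i k; rewrite mxE.
  by case: eqVneq => [->//|i0]; rewrite (hY i).
by rewrite hX ?mul0r.
Qed.

(** [top_form_left_mu] removes the sum over j and [top_form_wedge1_vcons] the one over i. The factor
    d+1 of the trace cancels against the d+1 rows r, and exactly -1 remains, so that the Lee form is
    s_00 with coefficient 1. *)
Lemma top_form_lee X Y a (w : 'I_q.+1 -> V) :
  (forall i k, i != a -> X i k = 0) -> (forall i k, i != a -> Y i k = 0) ->
  \sum_(i < q.+1) (-1) ^+ i *
    \sum_j O (vcons X (vcons Y
      [eta w \o lift i with j |-> left_mu (w i) (w (lift i j))])) =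
  - \sum_(i < q.+1) (-1) ^+ i * (w i 0 0 * O (vcons X (vcons Y (w \o lift i)))).
Proof.
move=> hX hY; pose B Z := O (vcons Z w).
have B0 : B 0 = 0 by rewrite /B -(vcons_upd0 0) multilinear0.
have SE r s Z Z' := top_form_wedge1_vcons w Z Z' r s mO aO dq.
have row0 Z r : (delta_mx r 0 *m Z) r 0 = Z 0 0.
  rewrite mxE (bigD1 0) //= mxE !eqxx mul1r big1 ?addr0 // => l /negPf l0.
  by rewrite mxE l0 andbF mul0r.
(* The three parts come from the trace, from [left_mu] acting on [X] and from [left_mu] acting on
   [Y]; [left_mu_sum] splits the last two into rows. *)
transitivity (d.+1%:R * (Y 0 0 * B X - X 0 0 * B Y)
  - \sum_r (Y r 0 * B (delta_mx r 0 *m X) - (delta_mx r 0 *m X) r 0 * B Y)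
  - \sum_r ((delta_mx r 0 *m Y) r 0 * B X - X r 0 * B (delta_mx r 0 *m Y))).
  rewrite /B -SE mulr_sumr; under [X in _ = _ - X]eq_bigr do rewrite -SE.
  under [X in _ = _ - X - _]eq_bigr do rewrite -SE.
  rewrite exchange_big [X in _ = _ - X]exchange_big -!sumrB; apply: eq_bigr => i _ /=.
  rewrite (top_form_left_mu X Y (w i) (w \o lift i)) !mulrBr.
  congr (_ - _ - _).
  - by rewrite -mulrA mulrCA.
  - rewrite -mulr_sumr; congr (_ * _); rewrite left_mu_sum.
    rewrite -(vcons_upd0 0) multilinear_sum //; apply: eq_bigr => r _.
    by rewrite multilinearZ // vcons_upd0.
  - rewrite -mulr_sumr; congr (_ * _); rewrite left_mu_sum.
    rewrite -(vcons_upd0 0 (\sum_r _)) -vcons_updS multilinear_sum //; apply: eq_bigr => r _.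
    by rewrite multilinearZ // vcons_updS vcons_upd0.
under eq_bigr do rewrite row0.
under [X in _ - X]eq_bigr do rewrite row0.
(* Here it matters that [X] and [Y] are supported in the same row. *)
rewrite !sumrB (sum_row_delta (a := a)) // (sum_row_delta (a := a)) //.
have sumC (x : R) : \sum_(r < d.+1) x = d.+1%:R * x.
  by rewrite sumr_const card_ord mulr_natl.
by rewrite !sumC SE /B; ring.
Qed.

End Lee.

(** Up to a factor, [W k] is a contraction of the top form [W k.+1], so [top_form_lee] applies to
    each summand. The hypothesis makes k equal to n - 1, for n the complex dimension. *)
Lemma kahler_pow_lee k (w : 'I_k.*2.+1 -> V) : (d.+1 * d.+1 = k.+1.*2)%N ->
  \sum_(i < k.*2.+1) (-1) ^+ i *
    \sum_(j < k.*2) W k [eta w \o lift i with j |-> left_mu (w i) (w (lift i j))] =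
  - \sum_(i < k.*2.+1) (-1) ^+ i * (w i 0 0 * W k (w \o lift i)).
Proof.
move=> dk.
pose C (u : 'I_k.*2 -> V) : R :=
  \sum_a \sum_b W k.+1 (vcons (delta_mx a b) (vcons (Jmul (delta_mx a b)) u)).
(* The factor in [kahler_pow_contraction] is (k+1) (2(k+1) - 2k) = 2(k+1). *)
have CE u : W k u = (k.+1.*2)%:R^-1 * C u.
  rewrite /C kahler_pow_contraction dk -natrB ?leq_double // -doubleB subSnn -natrM muln2.
  by rewrite mulKf // pnatr_eq0.
have E : \sum_(i < k.*2.+1) (-1) ^+ i *
    \sum_(j < k.*2) C [eta w \o lift i with j |-> left_mu (w i) (w (lift i j))] =
  - \sum_(i < k.*2.+1) (-1) ^+ i * (w i 0 0 * C (w \o lift i)).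
  rewrite /C.
  under eq_bigr do rewrite exchange_big mulr_sumr.
  rewrite exchange_big.
  under [X in _ = - X]eq_bigr do rewrite !mulr_sumr.
  rewrite [X in _ = - X]exchange_big -sumrN; apply: eq_bigr => a _ /=.
  under eq_bigr do rewrite exchange_big mulr_sumr.
  rewrite exchange_big.
  under [X in _ = - X]eq_bigr do rewrite !mulr_sumr.
  rewrite [X in _ = - X]exchange_big -sumrN; apply: eq_bigr => b _ /=.
  have := @top_form_lee k.*2 (W k.+1) _ _ _ _ _ a w; apply.
  - exact (multilinear_wedge_pow multilinear_kahler (k := k.+1) (0 : V)).
  - exact (alternating_wedge_pow kahler (k := k.+1) (0 : V)).
  - by rewrite dk.
  (* J only moves columns, so [delta_mx a b] and its image both lie in row a. *)
  - by move=> i l /negPf ia; rewrite mxE ia.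
  - by move=> i l /negPf ia; rewrite Jmul_delta !mxE ia mulr0.
transitivity (k.+1.*2%:R^-1 * \sum_(i < k.*2.+1) (-1) ^+ i *
    \sum_(j < k.*2) C [eta w \o lift i with j |-> left_mu (w i) (w (lift i j))]).
  rewrite mulr_sumr; apply: eq_bigr => i _; rewrite mulrCA; congr (_ * _).
  by rewrite mulr_sumr; apply: eq_bigr => j _; rewrite CE.
rewrite E mulrN mulr_sumr; congr (- _); apply: eq_bigr => i _.
by rewrite CE mulrCA; congr (_ * _); rewrite mulrCA.
Qed.

End MatrixSpace.

(** * Product rules for forms with constant coefficients *)

Section Derivatives.
Context {R : realType} {V : normedModType R}.

Lemma is_derive_bigsum (I : Type) (r : seq I) (f : I -> V -> R) (df : I -> R) x u :
  (forall i, is_derive x u (f i) (df i)) ->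
  is_derive x u (fun y => \sum_(i <- r) f i y) (\sum_(i <- r) df i).
Proof.
move=> hf; elim: r => [|i r IH].
  rewrite big_nil (_ : (fun y => _) = cst 0); first exact: is_derive_cst.
  by apply/funext => y; rewrite big_nil.
rewrite big_cons (_ : (fun y => _) = f i + (fun y => \sum_(j <- r) f j y)).
  exact: is_deriveD.
by apply/funext => y; rewrite big_cons.
Qed.

Lemma is_derive_mul (f g : V -> R) x u df dg :
  is_derive x u f df -> is_derive x u g dg ->
  is_derive x u (fun y => f y * g y) (df * g x + f x * dg).
Proof.
move=> hf hg; apply: (is_derive_eq (is_deriveM hf hg)).
by rewrite addrC; congr (_ + _); apply: mulrC.
Qed.

Lemma is_derive_scale (f : V -> R) x u a df :
  is_derive x u f df -> is_derive x u (fun y => a * f y) (a * df).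
Proof. by move=> hf; apply: is_deriveZ. Qed.

End Derivatives.

Section LeibnizRule.
Context {R : realType} {d : nat}.
Local Notation V := 'M[R]_d.+1.
Variables x u : V.

(** Product rule for a constant form on moving arguments [c i y]. As a predicate on [T] it passes to
    wedge powers by induction; derivatives are entrywise, as they are known for the coframe. *)
Definition leibniz k (T : ('I_k -> V) -> R) :=
  forall (c : 'I_k -> V -> V) (dc : 'I_k -> V),
    (forall i r s, is_derive x u (fun y => c i y r s) (dc i r s)) ->
    is_derive x u (fun y => T (fun i => c i y))
      (\sum_j T [eta (fun i => c i x) with j |-> dc j]).

Lemma leibniz_wedge p q (S : tensor V p) (T : tensor V q) (x0 : V) :
  leibniz (S x0) -> leibniz (T x0) -> leibniz (wedge S T x0).
Proof.
move=> hS hT c dc hc; under eq_fun do rewrite wedgeE.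
rewrite (eq_bigr (fun j => (p`! * q`!)%:R^-1 *
  alt (tens (S x0) (T x0)) [eta (fun i => c i x) with j |-> dc j])); last first.
  by move=> j _; rewrite wedgeE.
rewrite -mulr_sumr; apply: is_derive_scale; rewrite /alt exchange_big /=.
apply: is_derive_bigsum => s; rewrite -mulr_sumr; apply: is_derive_scale.
(* The differentiated slot is renamed through s, so that the first p slots fall on [S] and the
   others on [T]. *)
rewrite (reindex_inj (@perm_inj _ s)) big_split_ord /= /tens.
have := is_derive_mul
  (hS (fun i => c (s (lshift q i))) (fun i => dc (s (lshift q i))) (fun i => hc _))
  (hT (fun i => c (s (rshift p i))) (fun i => dc (s (rshift p i))) (fun i => hc _)).
rewrite mulr_suml mulr_sumr => /is_derive_eq; apply; congr (_ + _).
all: apply: eq_bigr => j _; congr (S x0 _ * T x0 _); apply/funext => i /=.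
all: by rewrite (inj_eq perm_inj) eq_shift.
Qed.

Lemma leibniz_kahler : leibniz kahler.
Proof.
move=> c dc hc; rewrite 2!big_ord_recl big_ord0 addr0.
rewrite /kahler /frob -big_split; apply: is_derive_bigsum => r.
rewrite -big_split; apply: is_derive_bigsum => s /=.
under eq_fun do rewrite JmulE -mulrA.
rewrite !JmulE -!mulrA -mulrDr; apply: is_derive_scale.
have := is_derive_mul (hc ord0 r (conj_index s)) (hc ord_max r s).
by rewrite (_ : lift ord0 ord0 = ord_max); last exact/val_inj.
Qed.

Lemma leibniz_wedge_pow k (x0 : V) : leibniz (wedge_pow (fun=> kahler) k x0).
Proof.
elim: k => [|k IH]; last first.
  exact (leibniz_wedge (S := fun=> kahler) leibniz_kahler IH).
by move=> c dc _; rewrite big_ord0 /=; apply: is_derive_cst.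
Qed.

End LeibnizRule.

(** Powers only permute the arguments, so they commute with any substitution f. With the coframe as
    f, this reduces the fundamental form to the constant form [kahler]. *)
Lemma eq_wedge_pow {R : realType} {V : normedModType R} (S T : tensor V 2)
    (x y : V) (f : V -> V) k :
  (forall v, S x v = T y (f \o v)) ->
  forall v, wedge_pow S k x v = wedge_pow T k y (f \o v).
Proof.
move=> ST; elim: k => //= k IH v; congr (_ * _); apply: eq_bigr => s _.
by rewrite ST IH.
Qed.

(** * Smooth functions on open sets *)

Section SmoothFunctions.
Context {R : realType} {V : normedModType R}.
Implicit Types (U : set V) (f g : V -> R).

Lemma open_near_eq U f g x : open U -> (forall y, U y -> f y = g y) -> U x ->
  \near x, f x = g x.
Proof. by move=> oU fg Ux; apply: filterS (open_nbhs_nbhs (conj oU Ux)). Qed.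

Lemma Ck_ext k U f g : open U -> (forall x, U x -> f x = g x) ->
  Ck k U f -> Ck k U g.
Proof.
move=> oU; elim: k f g => [|k IH] f g fg [cf df].
all: have cg x : U x -> {for x, continuous g} by
  (move=> Ux; rewrite /prop_for /continuous_at /= -(fg x Ux);
   apply: cvg_trans (cf x Ux); apply: near_eq_cvg; apply: open_near_eq Ux).
all: split.
- exact: cg.
- by [].
- exact: cg.
move=> v; have [dv cv] := df v; split=> [x Ux|].
  exact: near_eq_derivable (open_near_eq oU fg Ux) (dv x Ux).
apply: IH cv => x Ux; exact/near_eq_derive/(open_near_eq oU fg Ux).
Qed.

Lemma CkW k U f : Ck k.+1 U f -> Ck k U f.
Proof.
elim: k f => [|k IH] f [cf df]; split=> // v.
by have [dv cv] := df v; split=> //; exact: IH.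
Qed.

Lemma Ck_cst k U (a : R) : Ck k U (cst a).
Proof.
elim: k a => [|k IH] a; (split; first by move=> x _; exact: cst_continuous) => // v.
split=> [x _|]; first exact: derivable_cst.
by rewrite (_ : (fun x => _) = cst 0) //; apply/funext => x; rewrite derive_cst.
Qed.

Lemma Ck_add k U f g : open U -> Ck k U f -> Ck k U g ->
  Ck k U (fun x => f x + g x).
Proof.
move=> oU; elim: k f g => [|k IH] f g [cf df] [cg dg];
  (split; first by move=> x Ux; apply: cvgD; [exact: cf|exact: cg]) => // v.
have [dvf cvf] := df v; have [dvg cvg] := dg v; split=> [x Ux|].
  by apply: derivableD; [exact: dvf|exact: dvg].
apply: Ck_ext (IH _ _ cvf cvg) => // x Ux.
by rewrite -deriveD //; [exact: dvf|exact: dvg].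
Qed.

Lemma Ck_mul k U f g : open U -> Ck k U f -> Ck k U g ->
  Ck k U (fun x => f x * g x).
Proof.
move=> oU; elim: k f g => [|k IH] f g Cf Cg;
  (split; first by move=> x Ux; apply: cvgM; [exact: Cf.1|exact: Cg.1]) => // v.
have [dvf cvf] := Cf.2 v; have [dvg cvg] := Cg.2 v; split=> [x Ux|].
  by apply: derivableM; [exact: dvf|exact: dvg].
apply: (@Ck_ext _ _ (fun x => f x * 'D_v g x + g x * 'D_v f x)) => //.
  by move=> x Ux; rewrite deriveM //; [exact: dvf|exact: dvg].
by apply: Ck_add => //; apply: IH => //; exact: CkW.
Qed.

(** The derivative - (1/f)^2 f' is a product of functions that are C^k by induction. *)
Lemma Ck_inv k U f : open U -> (forall x, U x -> f x != 0) -> Ck k U f ->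
  Ck k U (fun x => (f x)^-1).
Proof.
move=> oU f0; elim: k => [|k IH] Cf;
  (split; first by move=> x Ux; apply: cvgV; [exact: f0|exact: Cf.1]) => // v.
have [dvf cvf] := Cf.2 v; split=> [x Ux|].
  by apply: derivableV; [exact: f0|exact: dvf].
apply: (@Ck_ext _ _ (fun x => (- 1 * ((f x)^-1 * (f x)^-1)) * 'D_v f x)) => //.
  move=> x Ux; rewrite deriveV ?f0 //; last exact: dvf.
  by rewrite expr2 invfM mulN1r.
have If := IH (CkW Cf).
by do 2?apply: Ck_mul => //; [exact: Ck_cst|exact: Ck_mul].
Qed.

Lemma smooth_sum U (I : Type) (r : seq I) (f : I -> V -> R) : open U ->
  (forall i, smooth U (f i)) -> smooth U (fun x => \sum_(i <- r) f i x).
Proof.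
move=> oU sf k; elim: r => [|i r IH].
  rewrite (_ : (fun x => _) = cst 0); first exact: Ck_cst.
  by apply/funext => x; rewrite big_nil.
rewrite (_ : (fun x => _) = (fun x => f i x + \sum_(j <- r) f j x)).
  by apply: Ck_add => //; apply: sf.
by apply/funext => x; rewrite big_cons.
Qed.

End SmoothFunctions.

(** * Calculus in matrix coordinates *)

Section MatrixCalculus.
Context {R : realType} {d : nat}.
Local Notation V := 'M[R]_d.+1.

Lemma is_derive_coord (x u : V) i j : is_derive x u (fun y : V => y i j) (u i j).
Proof.
apply: DeriveDef; first exact/diff_derivable/differentiable_coord.
have /matrixP/(_ i j) := derive_mx (@derivable_id R V x u).
by rewrite derive_id mxE.
Qed.

Lemma smooth_coord (U : set V) i j : smooth U (fun y : V => y i j).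
Proof.
case=> [|k]; (split; first by move=> x _; exact: coord_continuous) => // v.
split=> [x _|]; first by have [] := is_derive_coord x v i j.
rewrite (_ : (fun x => _) = cst (v i j)); first exact: Ck_cst.
by apply/funext => x; have [_ ->] := is_derive_coord x v i j.
Qed.

Lemma cvg_mx {T : Type} {F : set_system T} {FF : Filter F} m n
    (f : T -> 'M[R]_(m.+1, n.+1)) (l : 'M[R]_(m.+1, n.+1)) :
  (forall i j, f x i j @[x --> F] --> l i j) -> f @ F --> l.
Proof.
move=> fl; apply/cvgrPdist_le => e e0; near=> x.
rewrite [leLHS]/Num.Def.normr/= mx_normrE (bigmax_le _ (ltW e0)) //= => i _.
rewrite !mxE; move: i; near: x; apply: filter_forall => /= i.
exact: ((cvgrPdist_le _ _).1 (fl i.1 i.2)).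
Unshelve. all: by end_near. Qed.

End MatrixCalculus.

(** The first-order expansion of [g] at [x] is also one of [f], and the differential is unique. *)
Lemma near_eq_diff {R : realType} {V W : normedModType R} (f g : V -> W) x :
  differentiable g x -> {near x, f =1 g} -> 'd f x = 'd g x :> (V -> W).
Proof.
move=> dg fg; apply: diff_unique; first exact: diff_continuous.
have /eqaddoP hg := diff_locally dg; apply/eqaddoP => e e0.
have fg0 : \forall h \near 0, f (h + x) = g (h + x).
  by have := fg; rewrite (near_shift 0) /=; apply: filterS => h; rewrite /= subr0.
apply: filterS2 fg0 (hg e e0) => h /= fgh; rewrite -!fctE /=.
by rewrite !fctE /= fgh (nbhs_singleton fg).
Qed.

(** * The group law in coordinates *)

Section GroupLaw.
Context {R : realType} {d : nat}.
Local Notation V := 'M[R]_d.+1.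
Implicit Types x y h v : V.

(** The matrix is the identity with its first column replaced by that of [h]; the constant part
    added in [transl] is [h] without its first column. *)
Definition transl_diff h : V -> V := mulmx (1%:M + (h - 1%:M) *m delta_mx 0 0).

Definition transl h x : V :=
  transl_diff h x + \matrix_(i, k) (if k == ord0 then 0 else h i k).

Lemma transl_diffE h v i k :
  transl_diff h v i k = v i k + (h i 0 - (i == 0)%:R) * v 0 k.
Proof.
rewrite /transl_diff mulmxDl mul1mx mxE; congr (_ + _).
by rewrite -[LHS]/(left_mu _ _ i k) left_muE !mxE.
Qed.

Lemma translE h x i k : transl h x i k =
  x i k + (h i 0 - (i == 0)%:R) * x 0 k + (if k == ord0 then 0 else h i k).
Proof. by rewrite mxE transl_diffE mxE. Qed.

Lemma grpmx_mul (al al' : R) (a a' : 'rV[R]_d) (b b' : 'cV[R]_d) (c c' : 'M[R]_d) :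
  grpmx al a b c *m grpmx al' a' b' c' =
  grpmx (al * al') (al *: a' + a) (b' + al' *: b) (c' + (b *m a' + c)).
Proof.
rewrite /grpmx mulmx_block !mul1mx !mul0mx !mulmx0 !addr0 add0r.
rewrite mulmx_block !mul0mx !mulmx0 !mulmx1 !addr0 !add0r mul_row_block.
rewrite !mul_scalar_mx scale_scalar_mx mul_mx_scalar mulmx0 addr0 mulmx1 add_row_mx.
congr block_mx; congr row_mx; apply/matrixP => i j; rewrite !mxE //.
by congr (_ + (_ + _)); apply: eq_bigr => l _; rewrite !mxE ord1.
Qed.

Lemma grp_of_mul h x : grp_of h *m grp_of x = grp_of (transl h x).
Proof.
rewrite /grp_of grpmx_mul; congr grpmx.
- by rewrite translE /=; ring.
- by apply/rowP => j; rewrite [RHS]mxE translE /= !mxE; ring.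
- by apply/colP => i; rewrite [RHS]mxE translE /= !mxE; ring.
- apply/matrixP => i j; rewrite [RHS]mxE translE /= !mxE big_ord1 !mxE.
  by ring.
Qed.

Lemma grp_of_inj : injective (@grp_of R d).
Proof.
move=> x y; rewrite /grp_of /grpmx => /eq_block_mx[_ /eq_row_mx[bE cE] _].
move=> /eq_block_mx[/matrixP/(_ 0 0) aE /rowP rE _ _].
apply/matrixP => i j; case: (unliftP ord0 i) => [i'|] ->;
  case: (unliftP ord0 j) => [j'|] ->.
- by have /matrixP/(_ (rev_ord i') j') := cE; rewrite !mxE rev_ordK.
- by have /colP/(_ (rev_ord i')) := bE; rewrite !mxE rev_ordK.
- by have := rE j'; rewrite !mxE.
- by move: aE; rewrite !mxE eqxx.
Qed.

(** The inverse of [transl_diff x], by the formula for a rank-one perturbation of the identity. *)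
Definition coframe x v : V := v - left_mu ((x 0 0)^-1 *: (x - 1%:M)) v.

Lemma coframeE x v i k :
  coframe x v i k = v i k - (x 0 0)^-1 * (x i 0 - (i == 0)%:R) * v 0 k.
Proof. by rewrite [LHS]mxE [X in _ + X]mxE left_muE !mxE. Qed.

Lemma coframe0E x v k : x 0 0 != 0 -> coframe x v 0 k = v 0 k / x 0 0.
Proof. by move=> x0; rewrite coframeE eqxx mulr1n; field. Qed.

(** Left invariance of the coframe: linear parts of translations multiply, so that of [h]
    cancels. *)
Lemma coframe_transl h x v : h 0 0 != 0 -> x 0 0 != 0 ->
  coframe (transl h x) (transl_diff h v) = coframe x v.
Proof.
move=> h0 x0; apply/matrixP => i k; rewrite !coframeE !translE !transl_diffE !eqxx mulr1n.
have -> : x 0 0 + (h 0 0 - 1) * x 0 0 + 0 = h 0 0 * x 0 0 by ring.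
by field; rewrite x0 h0.
Qed.

Lemma transl_coframe x v : x 0 0 != 0 -> transl_diff x (coframe x v) = v.
Proof.
move=> x0; apply/matrixP => i k.
by rewrite transl_diffE coframe0E // coframeE; field.
Qed.

Lemma grp_dom_transl h x : grp_dom h -> grp_dom x -> grp_dom (transl h x).
Proof.
rewrite /grp_dom /= translE eqxx mulrBl mul1r [X in X + _]addrC subrK addr0.
exact: mulr_gt0.
Qed.

Lemma grp_of_delta00 : grp_of (delta_mx 0 0 : V) = 1%:M :> 'M[R]_(d + (1 + d)).
Proof.
rewrite /grp_of /grpmx !mxE eqxx.
rewrite [X in row_mx X](_ : _ = 0); last by apply/colP => i; rewrite !mxE.
rewrite [X in row_mx _ X](_ : _ = 0); last by apply/matrixP => i j; rewrite !mxE.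
rewrite [\row_j _](_ : _ = 0); last by apply/rowP => i; rewrite !mxE.
by rewrite row_mx0 -!scalar_mx_block.
Qed.

Lemma G_inv (g : 'M[R]_(d + (1 + d))) : G d g -> G d (invmx g) /\ g \in unitmx.
Proof.
case=> x; rewrite /grp_dom /= => x0 <-.
have x0' : x 0 0 != 0 by rewrite gt_eqF.
(* Solution of [transl x y = delta_mx 0 0], the coordinates of the unit: the constant part is
   subtracted and the linear part inverted. *)
pose y := coframe x (delta_mx 0 0 - \matrix_(i, k) (if k == ord0 then 0 else x i k)).
have xy : grp_of x *m grp_of y = 1%:M.
  by rewrite grp_of_mul /transl transl_coframe // subrK grp_of_delta00.
have xu : grp_of x \in unitmx by have [] := mulmx1_unit xy.
split=> //; exists y; last by rewrite -[LHS](mulKmx xu) xy mulmx1.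
by rewrite /grp_dom /= coframe0E // !mxE !eqxx subr0 mul1r invr_gt0.
Qed.

Lemma subgroup_G : is_subgroup (G d : set 'M[R]_(d + (1 + d))) (G d).
Proof.
split=> // [|_ _ [x hx <-] [y hy <-]|g /G_inv[]//].
  by exists (delta_mx 0 0); [rewrite /grp_dom /= mxE eqxx|exact: grp_of_delta00].
by exists (transl x y); [exact: grp_dom_transl|rewrite grp_of_mul].
Qed.

Lemma grpmx_G (al : R) (a : 'rV[R]_d) (b : 'cV[R]_d) (c : 'M[R]_d) :
  0 < al -> G d (grpmx al a b c).
Proof.
move=> al0; pose x : V := \matrix_(i, j)
  oapp (fun i' => oapp (c i') (b i' 0) (unlift ord0 j))
       (oapp (a 0) al (unlift ord0 j)) (unlift ord0 i).
exists x; first by rewrite /grp_dom /= mxE unlift_none.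
rewrite /grp_of; congr grpmx; rewrite ?mxE ?unlift_none //.
- by apply/rowP => j; rewrite !mxE unlift_none liftK.
- by apply/colP => i; rewrite !mxE unlift_none liftK.
- by apply/matrixP => i j; rewrite !mxE !liftK.
Qed.

Section Orbits.
Variable L : set 'M[R]_(d + (1 + d)).
Hypothesis sL : is_subgroup (G d) L.

Lemma orbit_ofM (l x : 'M[R]_(d + (1 + d))) : L l -> orbit_of L (l *m x) = orbit_of L x.
Proof.
have [LG _ LM LV] := sL; move=> Ll; have [_ lu] := G_inv (LG _ Ll).
apply/seteqP; split=> y [k Lk ->].
  by exists (k *m l); [exact: LM|rewrite mulmxA].
exists (k *m invmx l); first by apply: LM => //; exact: LV.
by rewrite mulmxA mulmxKV.
Qed.

Lemma orbit_of_eq (x y : 'M[R]_(d + (1 + d))) :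
  orbit_of L y = orbit_of L x -> exists2 l, L l & y = l *m x.
Proof.
have [_ L1 _ _] := sL; move=> xy.
have : orbit_of L y y by exists 1%:M; rewrite ?mul1mx.
by rewrite xy.
Qed.

End Orbits.

Lemma subgroup_gen (A : set 'M[R]_(d + (1 + d))) : A `<=` G d ->
  is_subgroup (G d) (gen_subgroup (G d) A).
Proof.
move=> AG; split=> [g|D [_ D1 _ _] _ //|x y hx hy D sD AD|x hx D sD AD].
- by move=> /(_ _ subgroup_G AG).
- by have [_ _ DM _] := sD; apply: DM; [exact: hx|exact: hy].
- by have [_ _ _ DV] := sD; apply: DV; exact: hx.
Qed.

End GroupLaw.

(** * Pullback of invariant tensors along local left translations *)

Section Pullback.
Context {R : realType} {d : nat}.
Local Notation V := 'M[R]_d.+1.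
Local Notation M := 'M[R]_(d + (1 + d)).

HB.instance Definition _ (h : V) := GRing.Linear.on (transl_diff h).

Lemma continuous_transl_diff (h : V) : continuous (transl_diff h).
Proof.
move=> x; apply: (@cvg_mx R V (nbhs x) _) => i k.
have -> : (fun y : V => transl_diff h y i k) =
    fun y : V => y i k + (h i 0 - (i == 0)%:R) * y 0 k.
  by apply/funext => y; rewrite transl_diffE.
rewrite transl_diffE; apply: cvgD; first exact: coord_continuous.
by apply: cvgM; [exact: cvg_cst|exact: coord_continuous].
Qed.

Lemma is_diff_transl (h x : V) : is_diff x (transl h) (transl_diff h).
Proof.
have hd : is_diff x (transl_diff h) (transl_diff h).
  apply: DiffDef; first exact/linear_differentiable/continuous_transl_diff.
  exact/diff_lin/continuous_transl_diff.
set c := \matrix_(i, k) (if k == ord0 then 0 else h i k).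
have := is_diffD hd (is_diff_cst c x); rewrite addr0.
by rewrite -[_ + cst c]/(transl h).
Qed.

Lemma continuous_transl (h : V) : continuous (transl h).
Proof.
move=> x; have [dh _] := is_diff_transl h x.
exact: differentiable_continuous.
Qed.

Lemma diff_near_transl (t : V -> V) (h x : V) :
  (\forall y \near x, t y = transl h y) -> 'd t x = transl_diff h :> (V -> V).
Proof.
move=> th; have [dh <-] := is_diff_transl h x.
exact: near_eq_diff.
Qed.

Lemma open_grp_dom : open (grp_dom : set V).
Proof.
rewrite (_ : grp_dom = (fun x : V => x ord0 ord0) @^-1` [set a | 0 < a]) //.
by apply: open_comp; [move=> x _; exact: coord_continuous|exact: open_gt].
Qed.

Definition transl_invariant k (T : tensor V k) :=
  forall h x v, grp_dom h -> grp_dom x ->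
    T (transl h x) (fun i => transl_diff h (v i)) = T x v.

(** Serves for left translations of G, for the projection to the quotient and for changes of charts,
    since all of these are left translations in coordinates. *)
Lemma transl_invariant_pullback X Y (F : X -> Y) (A : set (Defs.patch V X))
    (B : set (Defs.patch V Y)) k (T : tensor V k) :
  transl_invariant T ->
  (forall p q x t, A p -> B q -> pdom p x -> local_rep F p q x t ->
    exists2 h, grp_dom h & grp_dom x /\ \forall y \near x, t y = transl h y) ->
  is_pullback F A B (fun=> T) (fun=> T).
Proof.
move=> iT FT p q x t Ap Bq px tF v.
have [h hh [hx th]] := FT p q x t Ap Bq px tF.
by rewrite (diff_near_transl th) (nbhs_singleton th) iT.
Qed.

Lemma local_rep_G (f : M -> M) h (x : V) t p q :
  grp_dom h -> (forall g, f g = grp_of h *m g) ->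
  atlasG d p -> atlasG d q -> pdom p x -> local_rep f p q x t ->
  grp_dom x /\ \forall y \near x, t y = transl h y.
Proof.
move=> hh fE -> -> /= px tF; split=> //; apply: filterS tF => y [_ tE].
by apply: grp_of_inj; rewrite -grp_of_mul -fE.
Qed.

Section Quotient.
Variable L : set M.
Hypothesis sL : is_subgroup (G d) L.

(* If t represents the projection and t x = l x with l in L, then l y lies in
   the chart domain for y near x, and injectivity of the chart gives t y = l y. *)
Lemma local_rep_orbit (X : Type) (F : X -> set M) (p : Defs.patch V X) q (x : V) t :
  (forall y, F (Defs.pmap p y) = orbit_of L (grp_of y)) ->
  atlas_quotient L q -> grp_dom x -> local_rep F p q x t ->
  exists2 h, grp_dom h & \forall y \near x, t y = transl h y.
Proof.
move=> FE [oq qG qE qi] hx tF; have [LG _ _ _] := sL.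
have [tx] := nbhs_singleton tF; rewrite FE qE /= => /(orbit_of_eq sL)[l Ll].
have [h hh lE] := LG _ Ll; rewrite -lE grp_of_mul => /grp_of_inj txE.
exists h => //.
have hq : \forall y \near x, pdom q (transl h y).
  have qx : nbhs (transl h x) (pdom q) by rewrite -txE; apply: open_nbhs_nbhs.
  exact: (@continuous_transl h x (pdom q) qx).
apply: filterS2 hq tF => y hy [ty tyE]; apply: qi => //.
rewrite tyE FE qE /= -grp_of_mul orbit_ofM //.
by rewrite lE.
Qed.

End Quotient.

End Pullback.

(** * The left-invariant metric and its Lee form *)

Section LeftInvariantMetric.
Context {R : realType} {d : nat}.
Local Notation V := 'M[R]_d.+1.
Local Notation M := 'M[R]_(d + (1 + d)).
Implicit Types x : V.

Lemma coframeP x a u v : coframe x (a *: u + v) = a *: coframe x u + coframe x v.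
Proof. by apply/matrixP => i k; rewrite !(coframeE, mxE); ring. Qed.

Lemma coframe_Jmul x v : coframe x (Jmul v) = Jmul (coframe x v).
Proof. by rewrite /coframe [RHS]linearB /=; congr (_ - _); rewrite /left_mu Jmul_mulmxl. Qed.

Lemma coframe_neq0 x v : x 0 0 != 0 -> v != 0 -> coframe x v != 0.
Proof.
move=> x0; apply: contraNneq => v0.
by rewrite -(transl_coframe v x0) v0 linear0.
Qed.

Lemma is_derive_coframe x u v r s : x 0 0 != 0 ->
  is_derive x u (fun y => coframe y v r s)
    ((- left_mu (coframe x u) (coframe x v)) r s).
Proof.
move=> x0; rewrite mxE left_muE coframe0E // coframeE.
have dV : is_derive x u (fun y : V => (y 0 0)^-1) (- (x 0 0) ^- 2 * u 0 0).
  have [d0 e0] := is_derive_coord x u 0 0.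
  by apply: DeriveDef; [exact: derivableV|rewrite deriveV // e0].
have dB : is_derive x u (fun y : V => y r 0 - (r == 0)%:R) (u r 0).
  by apply: is_derive_eq (is_deriveB (is_derive_coord x u r 0) (is_derive_cst _ _ _)) _;
    rewrite subr0.
have dC := is_derive_mul (is_derive_mul dV dB) (is_derive_cst (v 0 s) x u).
have := is_deriveB (is_derive_cst (v r s) x u) dC.
rewrite (_ : _ - _ = (fun y => coframe y v r s)); last first.
  by apply/funext => y; rewrite coframeE.
by move=> /is_derive_eq; apply; rewrite /cst; field.
Qed.

Lemma smooth_coframe (U : set V) (v : V) r s : open U -> U `<=` grp_dom ->
  smooth U (fun y => coframe y v r s).
Proof.
move=> oU UG k.
rewrite (_ : (fun y => _) =
  (fun y : V => v r s + (- v 0 s) * ((y 0 0)^-1 * (y r 0 + - (r == 0)%:R)))).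
  apply: Ck_add => //; first exact: Ck_cst.
  apply: Ck_mul => //; first exact: Ck_cst.
  apply: Ck_mul => //.
    by apply: Ck_inv => // [y /UG|]; [rewrite /grp_dom /= => /lt0r_neq0|exact: smooth_coord].
  by apply: Ck_add => //; [exact: smooth_coord|exact: Ck_cst].
by apply/funext => y; rewrite coframeE; ring.
Qed.

Definition inv_metric : tensor V 2 :=
  fun x v => frob (coframe x (v ord0)) (coframe x (v ord_max)).

(* The Lee form is d(log alpha'). *)
Definition lee_form : tensor V 1 := fun x v => v ord0 0 0 / x 0 0.

Lemma multilinear_inv_metric x : multilinear (inv_metric x).
Proof.
move=> v i a u w; rewrite /inv_metric /=.
have [->|->] : i = ord0 \/ i = ord_max.
  by case: i => [[|[|//]] hi]; [left|right]; apply/val_inj.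
- by rewrite !eqxx coframeP frobDl.
- by rewrite !eqxx /= coframeP frobDr.
Qed.

Lemma smooth_inv_metric (U : set V) : open U -> U `<=` grp_dom ->
  smooth_tensor U inv_metric.
Proof.
move=> oU UG; split=> [x _|v]; first exact: multilinear_inv_metric.
apply: smooth_sum => // i; apply: smooth_sum => // j k.
by apply: Ck_mul => //; apply: smooth_coframe.
Qed.

Lemma smooth_lee_form (U : set V) : open U -> U `<=` grp_dom ->
  smooth_tensor U lee_form.
Proof.
move=> oU UG; split=> [x _ v i a u w|v k].
  by rewrite ord1 /lee_form /= !mxE mulrDl mulrA.
apply: Ck_mul => //; first exact: Ck_cst.
by apply: Ck_inv => // [y /UG|]; [rewrite /grp_dom /= => /lt0r_neq0|exact: smooth_coord].
Qed.

Lemma inv_metric_invariant : transl_invariant inv_metric.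
Proof.
move=> h x v; rewrite /grp_dom /= => /lt0r_neq0 h0 /lt0r_neq0 x0.
by rewrite /inv_metric !coframe_transl.
Qed.

Lemma lee_form_invariant : transl_invariant lee_form.
Proof.
move=> h x v; rewrite /grp_dom /= => /lt0r_neq0 h0 /lt0r_neq0 x0.
rewrite /lee_form translE transl_diffE eqxx mulr1n.
have -> : x 0 0 + (h 0 0 - 1) * x 0 0 + 0 = h 0 0 * x 0 0 by ring.
by field; rewrite h0 x0.
Qed.

(** The derivative of the form along u, evaluated at w, is symmetric in u and w, so the two terms
    cancel. *)
Lemma ext_d_lee_form x v : x 0 0 != 0 -> ext_d lee_form x v = 0.
Proof.
move=> x0; rewrite /ext_d.
have D u w : 'D_u (fun y => lee_form y (fun=> w)) x = - (x 0 0) ^- 2 * u 0 0 * w 0 0.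
  have [d0 e0] := is_derive_coord x u 0 0.
  rewrite /lee_form.
  rewrite (_ : (fun y => _) = w 0 0 *: (fun y : V => (y 0 0)^-1)) //.
  rewrite deriveZ /=; last exact: derivableV.
  by rewrite deriveV // e0 /GRing.scale /= mulrC.
have E i : (fun j => v (lift i j)) = fun=> v (lift i ord0).
  by apply/funext => j; rewrite ord1.
rewrite 2!big_ord_recl big_ord0 addr0 !E !D mul1r expr1 mulN1r.
rewrite (_ : lift ord0 ord0 = ord_max); last exact/val_inj.
rewrite (_ : lift ord_max ord0 = ord0); last exact/val_inj.
by ring.
Qed.

Hypothesis od : odd d.

(** By the product rule and the structure equations, differentiation replaces each coframe value in
    turn by minus a [left_mu]; this leaves the algebraic identity [kahler_pow_lee]. *)
Lemma ext_d_wedge_pow k (w : tensor V 2) x v :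
  (d.+1 * d.+1 = k.+1.*2)%N -> x 0 0 != 0 ->
  (forall y u, w y u = kahler (coframe y \o u)) ->
  ext_d (wedge_pow w k) x v = wedge lee_form (wedge_pow w k) x v.
Proof.
move=> dk x0 wE.
pose W := wedge_pow (fun=> kahler) k (0 : V).
have WE y u : wedge_pow w k y u = W (coframe y \o u).
  by apply: eq_wedge_pow => u'; rewrite wE.
have mW : multilinear W := multilinear_wedge_pow multilinear_kahler (0 : V).
have aW : alternating W := alternating_wedge_pow kahler (0 : V).
have coE i a y z (u : 'I_k.*2 -> V) : coframe x \o [eta u with i |-> a *: y + z] =
    [eta coframe x \o u with i |-> a *: coframe x y + coframe x z].
  by apply/funext => j /=; case: eqP => // _; rewrite coframeP.
have coE1 i y (u : 'I_k.*2 -> V) : coframe x \o [eta u with i |-> y] =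
    [eta coframe x \o u with i |-> coframe x y].
  by apply/funext => j /=; case: eqP.
rewrite wedge1E; first last.
- by move=> u i j ij uij; rewrite WE; apply: aW ij _; rewrite /= uij.
- by move=> u i a y z; rewrite !WE coE mW !coE1.
transitivity (- \sum_(i < k.*2.+1) (-1) ^+ i * \sum_(j < k.*2)
    W [eta (fun l => coframe x (v l)) \o lift i with j |->
       left_mu (coframe x (v i)) (coframe x (v (lift i j)))]).
  rewrite /ext_d -sumrN; apply: eq_bigr => i _.
  rewrite -mulrN; congr (_ * _); rewrite -sumrN.
  under eq_fun do rewrite WE.
  have hW := @leibniz_wedge_pow _ _ x (v i) k (0 : V)
    (fun j y => coframe y (v (lift i j)))
    (fun j => - left_mu (coframe x (v i)) (coframe x (v (lift i j))))
    (fun j r s => is_derive_coframe _ _ _ _ x0).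
  have [_ ->] := hW; apply: eq_bigr => j _.
  exact: (multilinearN mW).
rewrite kahler_pow_lee // opprK; apply: eq_bigr => i _; congr (_ * _).
by rewrite WE coframe0E.
Qed.

(** * Atlases whose transition maps are left translations *)

Section Atlas.
Variables (X : Type) (A : set (Defs.patch V X)).
Hypothesis oA : forall p, A p -> open (pdom p) /\ pdom p `<=` grp_dom.
Hypothesis tA : forall p q x t, A p -> A q -> pdom p x -> local_rep id p q x t ->
  exists2 h, grp_dom h & \forall y \near x, t y = transl h y.

Lemma is_pullback_id k (T : tensor V k) :
  transl_invariant T -> is_pullback id A A (fun=> T) (fun=> T).
Proof.
move=> iT; apply: transl_invariant_pullback => // p q x t Ap Aq px tE.
have [h hh th] := tA Ap Aq px tE; exists h => //; split=> //.
by have [_] := oA Ap; apply.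
Qed.

Lemma hermitian_inv_metric : hermitian_metric Jmul A (fun=> inv_metric).
Proof.
split.
  split; last exact: is_pullback_id inv_metric_invariant.
  by move=> p /oA[oU UG]; apply: smooth_inv_metric.
move=> p x /oA[_ UG] /UG; rewrite /grp_dom /= => /lt0r_neq0 x0; split=> [u v|u u0|u v].
- exact: frobC.
- exact/frob_gt0/coframe_neq0.
- by rewrite /inv_metric /vec2 /= !coframe_Jmul frob_Jmul.
Qed.

Lemma LCB_inv_metric : LCB Jmul (d.+1 ^ 2)./2 A (fun=> inv_metric).
Proof.
split; first exact: hermitian_inv_metric.
exists (fun=> lee_form); split.
- split.
    split; last exact: is_pullback_id lee_form_invariant.
    by move=> p /oA[oU UG]; apply: smooth_lee_form.
  by move=> p x _ _ v i j; rewrite !ord1 eqxx.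
- move=> p x v /oA[_ UG] /UG; rewrite /grp_dom /= => /lt0r_neq0 x0.
  exact: ext_d_lee_form.
move=> p x v /oA[_ UG] /UG; rewrite /grp_dom /= => /lt0r_neq0 x0.
apply: ext_d_wedge_pow => //; last first.
  by move=> y u; rewrite /fundamental_form /inv_metric /kahler /vec2 /= coframe_Jmul.
(* Since d+1 is even, halving its square is exact; n > 0 makes [n.-1] a true predecessor. *)
have n0 : (0 < (d.+1 ^ 2)./2)%N by rewrite half_gt0 expnS expn1; case: (d) od.
by rewrite prednK // mulnn -[LHS]odd_double_half oddX /= od.
Qed.

End Atlas.

End LeftInvariantMetric.

Theorem proposition5p2 (R : realType) (m d : nat) (hd : d = m.*2.+1)
  (N : 'M[int]_(d.*2)) (al : R)
  (detN : \det N = 1)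
  (al_gt1 : 1 < al) (al_quad : real_quadratic_integer al)
  (diagN : diagonalizable (map_mx intr N : 'M[R]_(d.*2)))
  (eigN : char_poly (map_mx intr N : 'M[R]_(d.*2)) =
          ('X - al%:P) ^+ d * ('X - (al^-1)%:P) ^+ d)
  (a b : 'M[R]_(d, d.*2))
  (ha : eigenbasis (map_mx intr N) al a)
  (hb : eigenbasis (map_mx intr N) al^-1 b)
  (D : set 'M[R]_(d + (1 + d))) (latD : cocompact_lattice (Zgrp d) D)
  (zD : forall s t, D (grpmx 1 0 0 (emx a b s t)))
  (h : 'I_(d ^ 2) -> 'M[R]_d)
  (genD : D = gen_subgroup (Zgrp d) (range (fun k => grpmx 1 0 0 (h k))))
  (P : 'M[int]_(d.*2, d ^ 2))
  (c : 'I_(d.*2) -> 'M[R]_d)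
  (hc : forall k i j, c k i j =
    \sum_s (N k s)%:~R * c s i j + fmx N a b k i j
    + \sum_l (P k l)%:~R * h l i j) :
  exists (g : tfield 'M[R]_(d + (1 + d)) 2)
         (gX : tfield (set 'M[R]_(d + (1 + d))) 2),
    [/\ hermitian_metric Jmul (atlasG d) g,
        left_invariant g,
        is_pullback (orbit_of (Lambda al a b c h)) (atlasG d)
          (atlas_quotient (Lambda al a b c h)) g gX &
        LCB Jmul (d.+1 ^ 2)./2 (atlas_quotient (Lambda al a b c h)) gX].
Proof.
have od : odd d by rewrite hd /= odd_double.
have al0 : 0 < al by apply: lt_trans al_gt1.
set L := Lambda al a b c h.
have sL : is_subgroup (G d) L.
  (* The generators lie in G because their entry alpha' is [al] or 1. *)
  by apply: subgroup_gen => g [[->|[k _ <-]]|[k _ <-]]; apply: grpmx_G.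
(* One coordinate expression serves for both manifolds, since the charts of the quotient use the
   coordinates of G. *)
exists (fun=> inv_metric), (fun=> inv_metric); split.
- apply: hermitian_inv_metric => //.
    by move=> p ->; split; [exact: open_grp_dom|].
  (* On G a transition map represents the identity, which is translation by the unit. *)
  move=> p q x t Ap Aq px tE; exists (delta_mx 0 0); first by rewrite /grp_dom /= mxE.
  apply: (local_rep_G _ _ Ap Aq px tE).2; first by rewrite /grp_dom /= mxE.
  by move=> g; rewrite grp_of_delta00 mul1mx.
- move=> _ [l hl <-]; apply: transl_invariant_pullback inv_metric_invariant _.
  by move=> p q x t Ap Aq px tE; exists l => //; apply: local_rep_G tE.
- apply: transl_invariant_pullback inv_metric_invariant _.
  move=> p q x t -> Aq px tE; have [//|k hk kt] := local_rep_orbit sL _ Aq px tE.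
  by exists k.
- apply: LCB_inv_metric => // [p [? ? _ _] //|p q x t [_ pG pE _] Aq px tE].
  (* Transition maps of the quotient are the case of [local_rep_orbit] in which [F] is the
     identity. *)
  by apply: (local_rep_orbit sL _ Aq (pG x px) tE) => y; rewrite pE.
Qed.
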